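(* Let $M_1$ and $M_2$ be two disjoint, properly embedded hypersurfaces without boundary in $\mathbb{R}^{n+1}$. Assume that $M_2$ is complete with Ricci curvature bounded below. Let $R_{M_1}$ be the normalized scalar curvature of $M_1$ and suppose that $R_{M_1}\ge0$. Suppose also that $H_{M_1}$ is bounded and that $$\sup_{M_2}|\mathbf{H}_{M_2}|<\inf_{M_1}H_{M_1}.$$ Then $M_2$ cannot lie in the convex side of $M_1$.
   Context: Hypersurfaces are smooth and oriented. $H_M$ denotes the mean curvature function of a hypersurface $M$ (the average of the principal curvatures with respect to the chosen unit normal) and $\mathbf{H}_M$ its mean curvature vector. The normalized scalar curvature $R_M$ of a hypersurface $M^n\subset\mathbb{R}^{n+1}$ with shape operator $A$ is the scalar curvature divided by $n(n-1)$, so that the Gauss equation reads $\|A\|^2=n^2H_M^2-n(n-1)R_M$. Convex side: let $M\subset\mathbb{R}^{n+1}$ be a complete, properly embedded hypersurface with empty boundary whose mean curvature function with respect to a unit normal $\eta$ is positive. $M$ splits $\mathbb{R}^{n+1}$ into two connected components; the convex side of $M$ is the component towards which the mean curvature vector of $M$ points. *)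

(* Defs.v *)
From HB Require Import structures.
From mathcomp Require Import all_boot all_order all_algebra.
From mathcomp Require Import all_classical all_reals all_analysis.

Set Implicit Arguments.
Unset Strict Implicit.
Unset Printing Implicit Defensive.

Import Order.TTheory GRing.Theory Num.Theory.
Import numFieldNormedType.Exports.

Local Open Scope classical_set_scope.
Local Open Scope ring_scope.

(* The library norm on 'rV[R]_N is the sup norm: it is used below only for the
   topology and for differentiability.  All metric notions use [dot]. *)
Definition dot (R : realType) (N : nat) (u v : 'rV[R]_N) : R :=
  \sum_(i < N) u 0 i * v 0 i.

Definition enorm (R : realType) (N : nat) (u : 'rV[R]_N) : R :=
  Num.sqrt (dot u u).

(* C^oo on the open set U: every iterated directional derivative of f is
   Frechet differentiable at every point of U. *)
Definition smooth_on (R : realType) (V W : normedModType R)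
    (U : set V) (f : V -> W) : Prop :=
  forall (s : seq V) (x : V), U x ->
    differentiable (foldr (fun v (g : V -> W) (y : V) => 'D_v g y) f s) x.

Section Hypersurfaces.
Context (R : realType) (n : nat).
Notation V := 'rV[R]_n.+1.
Implicit Types (M C : set V) (eta X Y Z : V -> V) (p q u v w x y z : V).

(* A smooth embedded hypersurface without boundary of R^(n+1), possibly
   disconnected: locally the zero set of a smooth function with nonzero
   differential. *)
Definition embedded_hypersurface M : Prop :=
  forall p, M p -> exists (U : set V) (f : V -> R),
    [/\ open U, U p, smooth_on U f,
        exists v, 'D_v f p != 0
      & M `&` U = [set q | f q = 0] `&` U].

(* For an embedded submanifold, the inclusion is a proper map exactly when the
   image is a closed subset. *)
Definition properly_embedded_hypersurface M : Prop :=
  embedded_hypersurface M /\ closed M.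

Definition tangent_space M p : set V :=
  [set v | exists g : R -> V,
     [/\ g 0 = p, \forall t \near (0 : R), M (g t) & is_derive (0 : R) 1 g v]].

(* A choice of smooth unit normal.  Smoothness along M is smoothness of (an
   extension of) eta on an open neighbourhood of M.  Everything defined from
   eta below is used at points of M only, and differentiates eta in tangent
   directions only, so it does not depend on the extension. *)
Definition unit_normal M eta : Prop :=
  (exists U : set V, [/\ open U, M `<=` U & smooth_on U eta]) /\
  forall p, M p ->
    dot (eta p) (eta p) = 1 /\
    forall v, tangent_space M p v -> dot (eta p) v = 0.

Definition shape_operator eta p v : V := - 'D_v eta p.

(* Orthogonal projection onto the tangent space at p. *)
Definition tproj eta p v : V := v - dot v (eta p) *: eta p.

(* Metric trace over the tangent space at p of a bilinear form b.  The
   projections E_i of the standard basis vectors satisfy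
   \sum_i <E_i, v> E_i = v for v tangent, so \sum_i b E_i E_i is the sum of
   b over any orthonormal basis of the tangent space. *)
Definition ttrace eta p (b : V -> V -> R) : R :=
  \sum_(i < n.+1) let E := tproj eta p (delta_mx 0 i) in b E E.

(* The sum of the principal curvatures is the trace of the shape operator. *)
Definition mean_curvature eta p : R :=
  ttrace eta p (fun v w => dot (shape_operator eta p v) w) / n%:R.

Definition mean_curvature_vector eta p : V := mean_curvature eta p *: eta p.

(* Levi-Civita connection of the induced metric: the tangential part of the
   derivative in R^(n+1). *)
Definition nabla eta X Y : V -> V := fun q => tproj eta q ('D_(X q) Y q).

Definition lie_bracket X Y : V -> V := fun q => 'D_(X q) Y q - 'D_(Y q) X q.

(* Riemann tensor R(x,y)z at p for x, y, z tangent at p, evaluated (it is a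
   tensor) on the tangent fields q |-> tproj eta q x, etc., that extend them. *)
Definition riemann_curvature eta p x y z : V :=
  let X := fun q => tproj eta q x in
  let Y := fun q => tproj eta q y in
  let Z := fun q => tproj eta q z in
  nabla eta X (nabla eta Y Z) p - nabla eta Y (nabla eta X Z) p
  - nabla eta (lie_bracket X Y) Z p.

(* Ric(y,z) = trace of x |-> R(x,y)z, positive on round spheres. *)
Definition ricci_curvature eta p y z : R :=
  ttrace eta p (fun x w => dot (riemann_curvature eta p x y z) w).

Definition scalar_curvature eta p : R :=
  ttrace eta p (ricci_curvature eta p).

Definition normalized_scalar_curvature eta p : R :=
  scalar_curvature eta p / (n%:R * (n%:R - 1)).

Definition ricci_bounded_below M eta : Prop :=
  exists c : R, forall p v, M p -> tangent_space M p v ->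
    c * dot v v <= ricci_curvature eta p v v.

(* C^1 curves parametrized by [0, 1]; a C^1 map on [0, 1] extends to R. *)
Definition C1_curve_in M x y (g : R -> V) : Prop :=
  [/\ forall t : R, derivable g t 1, continuous (derive1 g),
      forall t : R, 0 <= t <= 1 -> M (g t), g 0 = x & g 1 = y].

Definition curve_length (g : R -> V) : \bar R :=
  (\int[@lebesgue_measure R]_(t in `[0%R, 1%R]) (enorm (derive1 g t))%:E)%E.

(* Riemannian distance of M, +oo between distinct components. *)
Definition intrinsic_dist M x y : \bar R :=
  ereal_inf [set curve_length g | g in C1_curve_in M x y].

Definition complete_hypersurface M : Prop :=
  forall u_ : nat -> V, (forall k, M (u_ k)) ->
    (forall e : R, 0 < e -> exists N : nat, forall k l : nat,
       (N <= k)%N -> (N <= l)%N -> (intrinsic_dist M (u_ k) (u_ l) < e%:E)%E) ->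
    exists2 p, M p & (fun k => intrinsic_dist M (u_ k) p) @ \oo --> 0%E.

(* M splits R^(n+1) into two connected components, and C is the one towards
   which the mean curvature vector of M points. *)
Definition is_convex_side M eta C : Prop :=
  (exists a b : V,
     [/\ (~` M) a, (~` M) b, C = connected_component (~` M) a,
         C `&` connected_component (~` M) b = set0
       & C `|` connected_component (~` M) b = ~` M]) /\
  forall p, M p ->
    \forall t \near (0 : R)^'+, C (p + t *: mean_curvature_vector eta p).

End Hypersurfaces.

(* Main.v *)
Require Import Defs.
From HB Require Import structures.
From mathcomp Require Import all_boot all_order all_algebra.
From mathcomp Require Import all_classical all_reals all_analysis.
From mathcomp Require Import ring lra.
Import Order.TTheory GRing.Theory Num.Theory.
Import numFieldNormedType.Exports.
Local Open Scope classical_set_scope.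
Local Open Scope ring_scope.

(** The proof compares the two hypersurfaces at a pair of points that almost
    realises their distance.

    Suppose that [M2] lies in the convex side [C] of [M1].  The distance
    between the two closed sets need not be attained, so for small [e > 0] one
    minimises the penalised distance [|y - x| + e * sqrt (1 + |x| ^ 2)] over
    [x] in [M1] and [y] in [M2].  The minimum is attained, at points [p] and
    [q] that differ because the hypersurfaces are disjoint
    ([penalised_distance_min]).  Let [u] be the unit vector from [p] to [q].

    To first order, [u] is normal to [M2] at [q] and makes an angle of order
    [e] with the normal of [M1] at [p].  As the penalty is [e]-Lipschitz, the
    segment from [q] to [p] meets [M1] only at [p], hence it stays in [C], and
    since [M1] is connected this forces [u] to point to the same side as the
    mean curvature vector ([convex_side_direction]): the normal of [M1] at [p]
    is close to [u], not to [- u].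

    To second order, move [p] and [q] along curves of [M1] and [M2] with
    velocities [v] and [w] such that [w - v] is parallel to [u].  For such pairs
    the second variation of the length contains only the normal accelerations,
    that is the second fundamental forms, and no term of order [1 / |q - p|];
    so nothing is lost if the distance tends to [0] with [e]
    ([second_variation]).  Summing over the projections along [u] of the
    standard basis gives [n * H2], up to sign, for [M2].  For [M1] it gives [n * H1] plus
    the second fundamental form at one vector of square length [O(e)]
    ([oblique_trace]).  That form is bounded uniformly on [M1], since by the
    Gauss equation its squared norm is [(n * H1) ^ 2] minus the scalar
    curvature, which is nonnegative ([gauss_equation]).  Hence
    [n * (inf H1 - sup |H2|) <= O(e)] ([mean_curvature_comparison]), and
    letting [e] tend to [0] contradicts the assumption on the mean
    curvatures.

    A hypersurface is used through a local equation [f = 0].  Its curves with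
    prescribed velocity are found by the intermediate value theorem, and their
    acceleration by a Taylor expansion ([level_set_curve]); the symmetry of the
    shape operator is that of the Hessian of [f] ([derive_sym]). *)

Set Implicit Arguments.
Unset Strict Implicit.
Unset Printing Implicit Defensive.

(** * Euclidean geometry of row vectors *)

Section EuclideanSpace.
Context {R : realType} {N : nat}.
Implicit Types (u v w x y : 'rV[R]_N) (k : R).

Lemma dotC u v : dot u v = dot v u.
Proof. by apply: eq_bigr => i _; rewrite mulrC. Qed.

Lemma dotDl u v w : dot (u + v) w = dot u w + dot v w.
Proof. by rewrite -big_split; apply: eq_bigr => i _; rewrite mxE mulrDl. Qed.

Lemma dotZl k u v : dot (k *: u) v = k * dot u v.
Proof. by rewrite mulr_sumr; apply: eq_bigr => i _; rewrite mxE mulrA. Qed.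

Lemma dotDr u v w : dot u (v + w) = dot u v + dot u w.
Proof. by rewrite dotC dotDl !(dotC u). Qed.

Lemma dotZr k u v : dot u (k *: v) = k * dot u v.
Proof. by rewrite dotC dotZl dotC. Qed.

Lemma dotNl u v : dot (- u) v = - dot u v.
Proof. by rewrite -scaleN1r dotZl mulN1r. Qed.

Lemma dotNr u v : dot u (- v) = - dot u v.
Proof. by rewrite dotC dotNl dotC. Qed.

Lemma dot0l u : dot 0 u = 0.
Proof. by rewrite -(scale0r u) dotZl mul0r. Qed.

Lemma dot0r u : dot u 0 = 0.
Proof. by rewrite dotC dot0l. Qed.

Definition dotE := (dotDl, dotDr, dotZl, dotZr, dotNl, dotNr, dot0l, dot0r).

Lemma dot_suml I (r : seq I) (F : I -> 'rV[R]_N) u :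
  dot (\sum_(i <- r) F i) u = \sum_(i <- r) dot (F i) u.
Proof.
elim: r => [|i r IH]; first by rewrite !big_nil dot0l.
by rewrite !big_cons dotDl IH.
Qed.

Lemma dot_delta u i : dot u (delta_mx 0 i) = u 0 i.
Proof.
rewrite /dot (bigD1 i)//= mxE !eqxx mulr1 big1 ?addr0// => j ji.
by rewrite mxE (negPf ji) andbF mulr0.
Qed.

Lemma sum_dot_delta u v :
  \sum_i dot u (delta_mx 0 i) * dot v (delta_mx 0 i) = dot u v.
Proof. by apply: eq_bigr => i _; rewrite !dot_delta. Qed.

Lemma row_sum_dot u : u = \sum_i dot u (delta_mx 0 i) *: delta_mx 0 i.
Proof.
rewrite [LHS]row_sum_delta; apply: eq_bigr => i _.
by rewrite dot_delta.
Qed.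

Lemma sum_dot_delta2 :
  \sum_(i < N) dot (delta_mx 0 i : 'rV[R]_N) (delta_mx 0 i) = N%:R.
Proof.
transitivity (\sum_(i < N) (1 : R)); last by rewrite sumr_const card_ord.
by apply: eq_bigr => i _; rewrite dot_delta mxE !eqxx.
Qed.

Lemma dot_ge0 u : 0 <= dot u u.
Proof. by apply: sumr_ge0 => i _; rewrite -expr2 sqr_ge0. Qed.

Lemma dot_eq0 u : (dot u u == 0) = (u == 0).
Proof.
apply/eqP/eqP => [h|->]; last by rewrite dot0l.
apply/rowP => i; rewrite mxE.
have /psumr_eq0P : forall i, true -> 0 <= u 0 i * u 0 i.
  by move=> j _; rewrite -expr2 sqr_ge0.
by move=> /(_ h i isT) /eqP; rewrite mulf_eq0 orbb => /eqP.
Qed.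

Lemma dot_gt0 u : u != 0 -> 0 < dot u u.
Proof. by move=> u0; rewrite lt_def dot_eq0 u0 dot_ge0. Qed.

Lemma dot_CS u v : dot u v ^+ 2 <= dot u u * dot v v.
Proof.
have [->|v0] := eqVneq v 0; first by rewrite !dot0r mulr0 expr0n.
have v2 := dot_gt0 v0.
have := dot_ge0 (dot v v *: u - dot u v *: v).
rewrite !dotE (dotC v u).
rewrite [leRHS](_ : _ = dot v v * (dot u u * dot v v - dot u v ^+ 2)); last by ring.
by rewrite pmulr_rge0// subr_ge0.
Qed.

Lemma enorm_ge0 u : 0 <= enorm u.
Proof. exact: sqrtr_ge0. Qed.

Lemma sqr_enorm u : enorm u ^+ 2 = dot u u.
Proof. by rewrite sqr_sqrtr// dot_ge0. Qed.

Lemma enorm_gt0 u : u != 0 -> 0 < enorm u.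
Proof. by move=> u0; rewrite sqrtr_gt0 dot_gt0. Qed.

Lemma enormZ k u : enorm (k *: u) = `|k| * enorm u.
Proof. by rewrite /enorm dotZl dotZr mulrA -expr2 sqrtrM ?sqr_ge0// sqrtr_sqr. Qed.

Lemma ler_dot_enorm u v : `|dot u v| <= enorm u * enorm v.
Proof.
rewrite -(ler_pXn2r (n := 2))// ?nnegrE ?mulr_ge0 ?enorm_ge0//.
by rewrite real_normK ?num_real// exprMn !sqr_enorm dot_CS.
Qed.

Lemma norm_le_enorm u : `|u| <= enorm u.
Proof.
rewrite {1}/Num.Def.normr/= mx_normrE; apply: bigmax_le => [|[i j] _ /=].
  exact: enorm_ge0.
rewrite -(ler_pXn2r (n := 2))// ?nnegrE ?enorm_ge0//.
rewrite real_normK ?num_real// sqr_enorm ord1 /dot (bigD1 j)//= -expr2 lerDl.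
by apply: sumr_ge0 => k _; rewrite -expr2 sqr_ge0.
Qed.

(** Tangent line to the concave square root. *)
Lemma sqrtr_le_tangent (a b : R) : 0 <= a -> 0 < b ->
  Num.sqrt a <= (a + b ^+ 2) / (2 * b).
Proof.
move=> a0 b0; rewrite ler_pdivlMr ?mulr_gt0//.
have := sqr_ge0 (Num.sqrt a - b); rewrite sqrrB sqr_sqrtr//.
by move: (Num.sqrt a) => s; lra.
Qed.

Lemma enorm_le_tangent u k : 0 < k -> enorm u <= (dot u u + k ^+ 2) / (2 * k).
Proof. exact/sqrtr_le_tangent/dot_ge0. Qed.

End EuclideanSpace.

(** * First-order calculus along lines and curves *)

Section SecondOrderCalculus.
Context {R : realType}.

Lemma mean_value0 (F dF : R -> R) (t : R) :
  (forall x : R, `|x| <= `|t| -> is_derive x 1 F (dF x)) ->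
  exists2 c, `|c| <= `|t| & F t - F 0 = dF c * t.
Proof.
move=> dFx.
have cF (a b : R) : (forall x, x \in `[a, b]%R -> `|x| <= `|t|) ->
    {within `[a, b], continuous F}.
  move=> ab; apply: derivable_within_continuous => x /ab /dFx.
  by move=> [].
have [t0|t0] := leP 0 t.
- have ab x : x \in `[0, t]%R -> `|x| <= `|t|.
    by rewrite in_itv/= => /andP[x0 xt]; rewrite !ger0_norm.
  have [x x0t|c c0t ->] := @MVT_segment R F dF _ _ t0 _ (cF _ _ ab).
    by apply: dFx; apply: ab; apply: subset_itv_oo_cc.
  by exists c; rewrite ?subr0//; exact: ab.
- have ab x : x \in `[t, 0]%R -> `|x| <= `|t|.
    by rewrite in_itv/= => /andP[tx x0]; rewrite !ler0_norm ?lerN2// ltW.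
  have [x x0t|c c0t e] := @MVT_segment R F dF _ _ (ltW t0) _ (cF _ _ ab).
    by apply: dFx; apply: ab; apply: subset_itv_oo_cc.
  exists c; first exact: ab.
  by rewrite -opprB e sub0r mulrN opprK.
Qed.

Context {V : normedModType R}.
Implicit Types (W : normedModType R) (p q v w : V).

Lemma is_derive_line W (f : V -> W) q v (s : R) :
  differentiable f (q + s *: v) ->
  is_derive s 1 (fun s : R => f (q + s *: v)) ('D_v f (q + s *: v)).
Proof.
move=> df.
have dl : is_diff s (fun s : R => q + s *: v) (fun s : R => s *: v).
  have := @is_diffD _ _ _ (cst q) (fun s : R => s *: v) 0 (fun s : R => s *: v) s _ _.
  by rewrite add0r; apply.
have dl' : differentiable (fun s : R => q + s *: v) s by [].
have dc := differentiable_comp dl' df.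
apply: DeriveDef; first exact: diff_derivable.
rewrite deriveE// (diff_comp dl' df) /= diff_val scale1r deriveE//.
Qed.

(** Chain rule along a curve, which need only be differentiable at [t]. *)
Lemma is_derive_curve W (f : V -> W) (g : R -> V) (t : R) v :
  is_derive t 1 g v -> differentiable f (g t) ->
  is_derive t 1 (f \o g) ('D_v f (g t)).
Proof.
move=> [dg gv] df.
have dg' : differentiable g t by apply/derivable1_diffP.
have dc := differentiable_comp dg' df.
apply: DeriveDef; first exact: diff_derivable.
by rewrite deriveE// (diff_comp dg' df) /= -(deriveE _ dg') gv deriveE.
Qed.

Lemma differentiable_expansion W (f : V -> W) p : differentiable f p ->
  forall e : R, 0 < e -> exists2 d : R, 0 < d &
    forall h, `|h| < d -> `|f (p + h) - f p - 'D_h f p| <= e * `|h|.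
Proof.
move=> df e e0; have /diff_locally/eqaddoP/(_ e e0)/nbhs_norm0P [d /= d0 H] := df.
exists d => // h hd; have := H h hd.
by rewrite !fctE /= [h + p]addrC deriveE// opprD addrA.
Qed.

Lemma continuous_norm W (f : V -> W) p : {for p, continuous f} ->
  forall e : R, 0 < e -> exists2 d : R, 0 < d &
    forall h, `|h| < d -> `|f (p + h) - f p| <= e.
Proof.
move=> /cvgrPdist_le cf e e0; have /nbhs_normP [d /= d0 H] := cf e e0.
exists d => // h hd; rewrite distrC; apply: H => /=.
by rewrite opprD addNKr normrN.
Qed.

Lemma is_derive_diff W (f : V -> W) p v : differentiable f p ->
  is_derive p v f ('D_v f p).
Proof. by move=> df; apply/derivableP; exact: diff_derivable. Qed.

Lemma deriveDv W (f : V -> W) p v w : differentiable f p ->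
  'D_(v + w) f p = 'D_v f p + 'D_w f p.
Proof. by move=> df; rewrite !deriveE// linearD. Qed.

Lemma deriveZv W (f : V -> W) p (k : R) v : differentiable f p ->
  'D_(k *: v) f p = k *: 'D_v f p.
Proof. by move=> df; rewrite !deriveE// linearZ. Qed.

End SecondOrderCalculus.

(** * Second-order expansions and symmetry of the second derivative *)

Section SecondOrderExpansion.
Context {R : realType} {V : normedModType R}.
Implicit Types (f : V -> R) (p v w a : V).

Lemma normZD_le (v a : V) (t s : R) :
  `|t *: v + s *: a| <= (`|v| + `|a|) * Num.max `|t| `|s|.
Proof.
rewrite (le_trans (ler_normD _ _))// !normrZ mulrDl.
by rewrite lerD// mulrC ler_wpM2l// le_max lexx ?orbT.
Qed.

(** The second derivative is symmetric: the second difference at scale [t]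
    is [t ^+ 2] times either mixed derivative, up to [o(t ^+ 2)]. *)
Lemma second_difference f p v w (U : set V) : open U -> U p ->
  (forall x, U x -> differentiable f x) ->
  differentiable ('D_v f) p ->
  forall e : R, 0 < e -> exists2 d : R, 0 < d & forall t : R, `|t| < d ->
    `|f (p + t *: v + t *: w) - f (p + t *: v) - f (p + t *: w) + f p
      - t ^+ 2 * 'D_w ('D_v f) p| <= e * t ^+ 2.
Proof.
move=> Uo Up df dDv e e0.
set C := `|v| + `|w| + 1.
have C0 : 0 < C by rewrite ltr_wpDl// addr_ge0.
have [d1 d10 H1] : exists2 d : R, 0 < d & forall h, `|h| < d -> U (p + h).
  have /nbhs_normP[d /= d0 H] := open_nbhs_nbhs (conj Uo Up).
  by exists d => // h hd; apply: H; rewrite /= opprD addNKr normrN.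
have e'0 : 0 < e / (2 * C) by rewrite divr_gt0// mulr_gt0.
have [d2 d20 H2] := differentiable_expansion dDv e'0.
exists (Num.min d1 d2 / C) => [|t]; first by rewrite divr_gt0// lt_min d10.
rewrite ltr_pdivlMr// => td.
have small (c b : R) : `|c| <= `|t| -> `|b| <= `|t| ->
    `|c *: v + b *: w| <= C * `|t|.
  move=> ct bt; rewrite (le_trans (ler_normD _ _))// !normrZ /C !mulrDl mul1r.
  rewrite -addrA lerD//; first by rewrite mulrC ler_wpM2l.
  by rewrite -[leLHS]addr0 lerD// mulrC ler_wpM2l.
have Ct1 : C * `|t| < d1 by move: td; rewrite mulrC lt_min => /andP[].
have Ct2 : C * `|t| < d2 by move: td; rewrite mulrC lt_min => /andP[].
(* The mean value theorem in the direction [v] reduces the second difference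
   to a difference of values of ['D_v f]. *)
pose F (s : R) := f (p + t *: w + s *: v) - f (p + s *: v).
pose dF (s : R) := 'D_v f (p + t *: w + s *: v) - 'D_v f (p + s *: v).
have dFE (s : R) : `|s| <= `|t| -> is_derive s 1 F (dF s).
  move=> st; apply: is_deriveB; apply: is_derive_line; apply: df.
    rewrite -addrA [t *: w + _]addrC; apply: H1.
    exact: le_lt_trans (small _ _ st (lexx _)) Ct1.
  apply: H1; rewrite -[s *: v]addr0 -(scale0r w).
  by apply: le_lt_trans (small _ _ st _) Ct1; rewrite normr0.
have [c ct] := mean_value0 dFE.
rewrite /F /dF !scale0r !addr0 => E.
rewrite (_ : _ - _ = ('D_v f (p + (c *: v + t *: w)) - 'D_v f p
   - 'D_(c *: v + t *: w) ('D_v f) p) * t -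
   ('D_v f (p + (c *: v + 0 *: w)) - 'D_v f p
   - 'D_(c *: v + 0 *: w) ('D_v f) p) * t); last first.
  rewrite !deriveDv// !deriveZv// !scale0r !addr0.
  rewrite [X in f X - _ - _](_ : _ = p + t *: w + t *: v); last first.
    by rewrite -!addrA [t *: v + _]addrC.
  rewrite [c *: v + _]addrC addrA.
  have alg (f1 f2 f3 f4 g1 g2 g3 g4 g5 : R) :
      f1 - f2 - (f3 - f4) = (g1 - g2) * t ->
      f1 - f2 - f3 + f4 - t ^+ 2 * g5 =
      (g1 - g3 - (c * g4 + t * g5)) * t - (g2 - g3 - c * g4) * t.
    by move=> /eqP; rewrite subr_eq subr_eq => /eqP ->; ring.
  exact: alg E.
have K (b : R) : `|b| <= `|t| ->
    `|('D_v f (p + (c *: v + b *: w)) - 'D_v f p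
   - 'D_(c *: v + b *: w) ('D_v f) p) * t| <= e / 2 * t ^+ 2.
  move=> bt; rewrite normrM -(real_normK (num_real t)) expr2 mulrA.
  rewrite ler_wpM2r//.
  apply: le_trans (H2 _ _) _; first exact: le_lt_trans (small _ _ ct bt) Ct2.
  rewrite (_ : e / 2 * `|t| = e / (2 * C) * (C * `|t|)); last first.
    by field; rewrite gt_eqF.
  by rewrite ler_wpM2l ?small// ltW.
rewrite (le_trans (ler_normB _ _))//.
by rewrite [in leRHS](splitr e) [in leRHS]mulrDl lerD// K// normr0.
Qed.

Lemma derive_sym f p v w (U : set V) : open U -> U p ->
  (forall x, U x -> differentiable f x) ->
  differentiable ('D_v f) p -> differentiable ('D_w f) p ->
  'D_w ('D_v f) p = 'D_v ('D_w f) p.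
Proof.
move=> Uo Up df dv dw; apply/eqP; rewrite -subr_eq0 -normr_eq0 eq_le normr_ge0 andbT.
apply/ler_addgt0Pr => e e0; rewrite add0r.
have e20 : 0 < e / 2 by rewrite divr_gt0.
have [d1 d10 H1] := second_difference w Uo Up df dv e20.
have [d2 d20 H2] := second_difference v Uo Up df dw e20.
pose t := Num.min d1 d2 / 2.
have t0 : 0 < t by rewrite divr_gt0// lt_min d10.
have td : t < Num.min d1 d2 by rewrite /t gtr_pMr ?invf_lt1 ?ltr1n// lt_min d10.
move: td; rewrite lt_min => /andP[td1 td2].
have := H1 t; have := H2 t; rewrite gtr0_norm// => /(_ td2) A /(_ td1) B.
have t2 : 0 < t ^+ 2 by rewrite exprn_gt0.
have alg (D b c f0 X Y T : R) : 0 < T ->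
    `|D - b - c + f0 - T * X| <= e / 2 * T ->
    `|D - c - b + f0 - T * Y| <= e / 2 * T -> `|X - Y| <= e.
  move=> T0 B' A'; rewrite -(ler_pM2r T0) -{1}(gtr0_norm T0) -normrM.
  rewrite (_ : (X - Y) * T =
    (D - c - b + f0 - T * Y) - (D - b - c + f0 - T * X)); last by ring.
  by rewrite (le_trans (ler_normB _ _))// [in leRHS](splitr e) [in leRHS]mulrDl lerD.
move: A; rewrite [p + t *: w + _]addrAC => A.
exact: alg t2 B A.
Qed.

(** Second-order Taylor expansion along [v], first-order along [a]. *)
Lemma taylor_line_shift f p v a (U : set V) : open U -> U p ->
  (forall x, U x -> differentiable f x) ->
  differentiable ('D_v f) p -> {for p, continuous ('D_a f)} ->
  forall e : R, 0 < e -> exists2 d : R, 0 < d & forall t s : R,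
    `|t| < d -> `|s| < d -> U (p + t *: v + s *: a) /\
    `|f (p + t *: v + s *: a) - f p - t * 'D_v f p
      - t ^+ 2 / 2 * 'D_v ('D_v f) p - s * 'D_a f p| <= e * (t ^+ 2 + `|s|).
Proof.
move=> Uo Up df dDv cDa e e0.
set C := `|v| + `|a| + 1.
have C0 : 0 < C by rewrite ltr_wpDl// addr_ge0.
have [d1 d10 H1] : exists2 d : R, 0 < d & forall h, `|h| < d -> U (p + h).
  have /nbhs_normP[d /= d0 H] := open_nbhs_nbhs (conj Uo Up).
  by exists d => // h hd; apply: H; rewrite /= opprD addNKr normrN.
have e'0 : 0 < e / C by rewrite divr_gt0.
have [d2 d20 H2] := differentiable_expansion dDv e'0.
have [d3 d30 H3] := continuous_norm cDa e0.
set d := Num.min d1 (Num.min d2 d3).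
have d0 : 0 < d by rewrite !lt_min d10 d20.
exists (d / C) => [|t s td sd]; first by rewrite divr_gt0.
have small (c b : R) : `|c| <= `|t| -> `|b| <= `|s| -> `|c *: v + b *: a| < d.
  move=> ct bs; have cd := le_lt_trans ct td; have bd := le_lt_trans bs sd.
  rewrite (@le_lt_trans _ _ ((`|v| + `|a|) * Num.max `|c| `|b|))//.
    exact: normZD_le.
  rewrite (@le_lt_trans _ _ (C * Num.max `|c| `|b|))//.
    by rewrite ler_wpM2r ?lerDl// le_max normr_ge0.
  by rewrite mulrC -ltr_pdivlMr// gt_max cd.
have dd1 : d <= d1 by rewrite ge_min lexx.
have dd2 : d <= d2 by rewrite !ge_min lexx orbT.
have dd3 : d <= d3 by rewrite !ge_min lexx !orbT.
have Uin (c b : R) : `|c| <= `|t| -> `|b| <= `|s| -> U (p + c *: v + b *: a).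
  by move=> ct bs; rewrite -addrA; apply: H1; exact: lt_le_trans (small _ _ ct bs) _.
split; first exact: Uin.
have [b bs Eb] := @mean_value0 R (fun s : R => f (p + t *: v + s *: a))
  (fun s : R => 'D_a f (p + t *: v + s *: a)) s
  (fun b bs => is_derive_line (df _ (Uin _ _ (lexx _) bs))).
have dG (c : R) : `|c| <= `|t| -> is_derive c 1
    (fun c : R => f (p + c *: v) - c * 'D_v f p - c ^+ 2 / 2 * 'D_v ('D_v f) p)
    ('D_v f (p + c *: v) - 'D_v f p - c * 'D_v ('D_v f) p).
  move=> ct; apply: is_deriveB; first apply: is_deriveB.
  - apply: is_derive_line; apply: df.
    by have := Uin c 0 ct; rewrite normr0 scale0r addr0; apply.
  - by apply: is_derive_eq; rewrite /GRing.scale/= mulr0 add0r mulr1.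
  - by apply: is_derive_eq; rewrite /GRing.scale/=; field.
have [c ct Ec] := mean_value0 dG.
move: Eb Ec; rewrite !scale0r !addr0 => Eb Ec.
rewrite (_ : _ - _ - _ = ('D_a f (p + t *: v + b *: a) - 'D_a f p) * s +
  ('D_v f (p + c *: v) - 'D_v f p - c * 'D_v ('D_v f) p) * t); last first.
  rewrite (_ : _ - s * _ = (f (p + t *: v + s *: a) - f (p + t *: v))
    + (f (p + t *: v) - t * 'D_v f p - t ^+ 2 / 2 * 'D_v ('D_v f) p -
      (f p - 0 * 'D_v f p - 0 ^+ 2 / 2 * 'D_v ('D_v f) p)) - s * 'D_a f p);
     last by field.
  by rewrite Eb Ec; ring.
rewrite (le_trans (ler_normD _ _))// mulrDr [leRHS]addrC lerD// normrM.
  rewrite ler_wpM2r// -[p + _ + _]addrA; apply: H3.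
  exact: lt_le_trans (small _ _ (lexx _) bs) _.
rewrite -(real_normK (num_real t)) expr2 mulrA ler_wpM2r//.
have := H2 (c *: v); rewrite deriveZv// normrZ => H.
apply: le_trans (H _) _.
  have := small c 0 ct; rewrite normr0 scale0r addr0 normrZ => S.
  exact: lt_le_trans (S _) dd2.
rewrite -mulrA ler_wpM2l ?(ltW e0)// mulrC ler_pdivrMr// ler_pM//.
by rewrite /C -addrA lerDl addr_ge0.
Qed.

End SecondOrderExpansion.

(** * Curves in level sets *)

Section LevelSetCurve.
Context {R : realType}.

Lemma is_derive0_quadratic (s : R -> R) (K : R) :
  (\forall t \near (0 : R), `|s t| <= K * t ^+ 2) -> is_derive (0 : R) 1 s 0.
Proof.
move=> sK; have s0 : s 0 = 0.
  by apply/eqP; rewrite -normr_le0 (le_trans (nbhs_singleton sK))// expr0n mulr0.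
have H : (fun h : R => h^-1 *: (s (h *: 1 + 0) - s 0)) @ 0^' --> (0 : R).
  apply/cvgr0Pnorm_le => e e0.
  have K1 : 0 < `|K| + 1 by rewrite ltr_wpDl.
  near=> h.
  have h0 : h != 0 by near: h; exact: nbhs_dnbhs_neq.
  rewrite s0 subr0 addr0 /GRing.scale/= mulr1 normrM normfV.
  rewrite ler_pdivrMl ?normr_gt0// (@le_trans _ _ (K * h ^+ 2))//.
    by near: h; exact: nbhs_dnbhs.
  rewrite -(real_normK (num_real h)) expr2 mulrCA ler_wpM2l//.
  rewrite (@le_trans _ _ ((`|K| + 1) * `|h|))//.
    by rewrite ler_wpM2r// (le_trans (ler_norm _))// lerDl.
  rewrite mulrC -ler_pdivlMr//; apply/ltW; near: h.
  by apply: dnbhs0_lt; rewrite divr_gt0.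
apply: DeriveDef; first by apply/cvg_ex; exists 0.
exact: cvg_lim H.
Unshelve. all: by end_near. Qed.

Context {V : normedModType R}.
Implicit Types (f : V -> R) (p v a : V) (M U : set V).

(** In a level set, a direction [v] of the kernel of the differential is the
    velocity of a curve that leaves its tangent line in a prescribed
    transversal direction [a]; the intermediate value theorem along [a]
    gives the points, and the Taylor expansion their distance to the line. *)
Lemma level_set_curve M U f p v a :
  open U -> U p -> M `&` U = [set q | f q = 0] `&` U ->
  (forall x, U x -> differentiable f x) ->
  differentiable ('D_v f) p -> {for p, continuous ('D_a f)} ->
  M p -> 'D_v f p = 0 -> 'D_a f p != 0 ->
  exists s : R -> R, forall e : R, 0 < e -> \forall t \near (0 : R),
    M (p + t *: v + s t *: a) /\
    `|s t - (- 'D_v ('D_v f) p / 'D_a f p) / 2 * t ^+ 2| <= e * t ^+ 2.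
Proof.
move=> Uo Up MU df dDv cDa Mp v0 a0.
set k := (- 'D_v ('D_v f) p / 'D_a f p) / 2.
set A := 'D_a f p in a0 *.
have fp : f p = 0.
  by have : (M `&` U) p by []; rewrite MU => -[].
have A0 : 0 < `|A| by rewrite normr_gt0.
set L := `|k| + 2.
have L0 : 0 < L by rewrite ltr_wpDl.
have est (e : R) : 0 < e -> exists2 d : R, 0 < d & forall t s : R, `|t| < d ->
    `|s - k * t ^+ 2| <= t ^+ 2 -> U (p + t *: v + s *: a) /\
    `|f (p + t *: v + s *: a) - A * (s - k * t ^+ 2)| <= e * `|A| * t ^+ 2.
  move=> e0; have e'0 : 0 < e * `|A| / L by rewrite divr_gt0 ?mulr_gt0.
  have [d d0 H] := taylor_line_shift Uo Up df dDv cDa e'0.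
  exists (Num.min d (Num.min 1 (d / L))).
    by rewrite !lt_min d0 ltr01 divr_gt0.
  move=> t s; rewrite !lt_min => /and3P[td t1 tL] st.
  have sL : `|s| <= (`|k| + 1) * t ^+ 2.
    rewrite -(subrK (k * t ^+ 2) s) (le_trans (ler_normD _ _))//.
    by rewrite mulrDl mul1r addrC lerD// normrM [ `|t ^+ 2|]ger0_norm ?sqr_ge0.
  have sL' : t ^+ 2 + `|s| <= L * t ^+ 2.
    by move: sL; rewrite /L; move: `|s| => x; lra.
  have sd : `|s| < d.
    apply: (@le_lt_trans _ _ (L * `|t|)); last by rewrite mulrC -ltr_pdivlMr.
    apply: le_trans (_ : L * t ^+ 2 <= _).
      by apply: le_trans sL'; rewrite lerDr sqr_ge0.
    rewrite ler_wpM2l ?(ltW L0)// -(real_normK (num_real t)) expr2.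
    by rewrite -[leRHS]mul1r ler_wpM2r// ltW.
  have [Uts Hts] := H t s td sd; split => //.
  rewrite (_ : _ - A * _ = f (p + t *: v + s *: a) - f p - t * 'D_v f p -
    t ^+ 2 / 2 * 'D_v ('D_v f) p - s * 'D_a f p); last first.
    rewrite fp v0 /k -/A; move: ('D_v _ _) (f _) => D x; field.
    exact: a0.
  apply: le_trans Hts _.
  rewrite (_ : e * `|A| * t ^+ 2 = e * `|A| / L * (L * t ^+ 2)); last first.
    by field; rewrite gt_eqF.
  by rewrite ler_wpM2l// ltW.
(* At the two ends [s - k * t ^+ 2 = +- t ^+ 2], an error of at most half of
   [`|A| * t ^+ 2] leaves opposite signs to [f]. *)
have half0 : (0 : R) < 1 / 2 by rewrite divr_gt0.
have [d d0 Hd] := est _ half0.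
have ex (t : R) : `|t| < d -> exists s, `|s - k * t ^+ 2| <= t ^+ 2 /\
    M (p + t *: v + s *: a).
  move=> td.
  have t2 := sqr_ge0 t.
  have lr : k * t ^+ 2 - t ^+ 2 <= k * t ^+ 2 + t ^+ 2 by lra.
  have itv (s : R) : s \in `[k * t ^+ 2 - t ^+ 2, k * t ^+ 2 + t ^+ 2]%R ->
      `|s - k * t ^+ 2| <= t ^+ 2.
    by rewrite in_itv/= ler_distl.
  have cf : {within `[k * t ^+ 2 - t ^+ 2, k * t ^+ 2 + t ^+ 2],
      continuous (fun s : R => f (p + t *: v + s *: a))}.
    apply: derivable_within_continuous => s /itv st.
    have [Us _] := Hd _ _ td st.
    by case: (is_derive_line (df _ Us)).
  have [|s /itv st fs] := @IVT R _ _ _ 0 lr cf.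
    have [//|_] := Hd t (k * t ^+ 2 - t ^+ 2) td.
      by rewrite addrC addrA addNr add0r normrN ger0_norm.
    have [//|_] := Hd t (k * t ^+ 2 + t ^+ 2) td.
      by rewrite addrC addrA addNr add0r ger0_norm.
    move: (f _) (f _) => x y.
    rewrite [_ + t ^+ 2 - _]addrC [_ - t ^+ 2 - _]addrC !addKr.
    rewrite !ler_distl ge_min le_max => /andP[y1 y2] /andP[x1 x2].
    have [Apos|Aneg] := leP 0 A.
      move: y1 y2 x1 x2; rewrite ger0_norm// => y1 y2 x1 x2.
      have At : 0 <= A * t ^+ 2 by rewrite mulr_ge0.
      have -> : x <= 0 by lra.
      have -> : 0 <= y by lra.
      by rewrite orbT.
    move: y1 y2 x1 x2; rewrite ltr0_norm// => y1 y2 x1 x2.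
    have At : A * t ^+ 2 <= 0 by rewrite mulr_le0_ge0// ltW.
    have -> : y <= 0 by lra.
    have -> : 0 <= x by lra.
    by rewrite orbT.
  exists s; split => //; have [Us _] := Hd _ _ td st.
  have : ([set q | f q = 0] `&` U) (p + t *: v + s *: a) by [].
  by rewrite -MU => -[].
pose s (t : R) := if pselect (`|t| < d) is left td then projT1 (cid (ex t td)) else 0.
have sP (t : R) : `|t| < d -> `|s t - k * t ^+ 2| <= t ^+ 2 /\
    M (p + t *: v + s t *: a).
  by move=> td; rewrite /s; case: pselect => // td'; case: cid.
exists s => e e0.
have [d' d'0 Hd'] := est _ e0.
near=> t.
have td : `|t| < d by near: t; exact: (@nbhs0_lt R R^o).
have td' : `|t| < d' by near: t; exact: (@nbhs0_lt R R^o).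
have [st Mt] := sP t td; split => //.
have [Ut] := Hd' t _ td' st.
have : (M `&` U) (p + t *: v + s t *: a) by [].
rewrite MU => -[/= -> _]; rewrite sub0r normrN normrM.
by rewrite [leRHS]mulrAC [leLHS]mulrC ler_pM2r.
Unshelve. all: by end_near. Qed.

End LevelSetCurve.

(** * Coordinates, gradients and tangent vectors *)

Section Coordinates.
Context {R : realType} {V : normedModType R} {N : nat}.
Implicit Types (F G : V -> 'rV[R]_N) (p v : V).

Lemma is_derive_coord F p v dF i : is_derive p v F dF ->
  is_derive p v (fun q => F q 0 i) (dF 0 i).
Proof.
move=> [dv <-]; apply: DeriveDef; first by move/derivable_mxP : dv; apply.
by rewrite derive_mx// mxE.
Qed.

Lemma is_derive_dot F G p v dF dG : is_derive p v F dF -> is_derive p v G dG ->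
  is_derive p v (fun q => dot (F q) (G q)) (dot dF (G p) + dot (F p) dG).
Proof.
move=> hF hG.
have H i : is_derive p v (fun q => F q 0 i * G q 0 i)
    (F p 0 i * dG 0 i + G p 0 i * dF 0 i).
  apply: is_deriveM; exact: is_derive_coord.
have := is_derive_sum (h := fun i q => F q 0 i * G q 0 i) H.
rewrite fct_sumE => h; apply: (is_derive_eq h).
by rewrite big_split addrC; congr (_ + _); apply: eq_bigr => i _; rewrite mulrC.
Qed.

Lemma derive_dotl F w p v : derivable F p v ->
  'D_v (fun q => dot (F q) w) p = dot ('D_v F p) w.
Proof.
move=> /derivableP hF.
have [_ ->] := is_derive_dot hF (is_derive_cst w p v).
by rewrite dot0r addr0.
Qed.

Lemma is_derive_scale (k : V -> R) F p v dk dF : is_derive p v k dk ->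
  is_derive p v F dF ->
  is_derive p v (fun q => k q *: F q) (k p *: dF + dk *: F p).
Proof.
move=> hk hF.
have H i : is_derive p v (fun q => (k q *: F q) 0 i)
   ((k p *: dF + dk *: F p) 0 i).
  rewrite (_ : (fun q => _) = (fun q => k q * F q 0 i)); last first.
    by apply/funext => q; rewrite mxE.
  apply: is_derive_eq; first exact/is_deriveM/is_derive_coord.
  by rewrite !mxE [dk * _]mulrC.
have dv : derivable (fun q => k q *: F q) p v.
  by apply/derivable_mxP => i j; rewrite ord1; case: (H j).
apply: DeriveDef => //; rewrite derive_mx//; apply/rowP => i.
by rewrite mxE; case: (H i).
Qed.

Lemma differentiable_dot F G p : differentiable F p -> differentiable G p ->
  differentiable (fun q => dot (F q) (G q)) p.
Proof.
move=> dF dG.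
rewrite (_ : (fun q => _) = \sum_(i < N) (fun q => F q 0 i * G q 0 i)).
  apply: differentiable_sum => i; apply: differentiableM.
    exact: (differentiable_comp dF (differentiable_coord _ _ _)).
  exact: (differentiable_comp dG (differentiable_coord _ _ _)).
by apply/funext => q; rewrite fct_sumE.
Qed.

End Coordinates.

Section Gradient.
Context {R : realType} {N : nat}.
Notation V := 'rV[R]_N.
Implicit Types (f : V -> R) (p q v w : V).

Definition grad f q : V := \sum_i 'D_(delta_mx 0 i) f q *: delta_mx 0 i.

Lemma derive_sumv (W : normedModType R) (F : V -> W) q I (r : seq I) (v : I -> V) :
  differentiable F q -> 'D_(\sum_(i <- r) v i) F q = \sum_(i <- r) 'D_(v i) F q.
Proof.
move=> dF; elim: r => [|i r IH]; first by rewrite !big_nil derive0.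
by rewrite !big_cons deriveDv// IH.
Qed.

Lemma derive_basis (W : normedModType R) (F : V -> W) q v : differentiable F q ->
  'D_v F q = \sum_i dot v (delta_mx 0 i) *: 'D_(delta_mx 0 i) F q.
Proof.
move=> dF; rewrite {1}(row_sum_dot v) derive_sumv//; apply: eq_bigr => i _.
by rewrite deriveZv.
Qed.

Lemma dot_grad f q v : differentiable f q -> dot (grad f q) v = 'D_v f q.
Proof.
move=> df; rewrite derive_basis// dot_suml; apply: eq_bigr => i _.
by rewrite dotZl dotC mulrC.
Qed.

Lemma differentiable_grad f q :
  (forall v, differentiable ('D_v f) q) -> differentiable (grad f) q.
Proof.
move=> df; rewrite (_ : grad f =
  \sum_(i < N) (fun q => 'D_(delta_mx 0 i) f q *: delta_mx 0 i)); last first.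
  by apply/funext => x; rewrite fct_sumE.
apply: differentiable_sum => i.
exact: (differentiableZl (k := 'D_(delta_mx 0 i) f)).
Qed.

End Gradient.

Section SmoothOn.
Context {R : realType} {V W : normedModType R}.
Implicit Types (U : set V) (f : V -> W).

Lemma smooth_on_differentiable U f x : smooth_on U f -> U x -> differentiable f x.
Proof. by move=> sf Ux; exact: (sf [::] x Ux). Qed.

Lemma smooth_on_derive U f v : smooth_on U f -> smooth_on U ('D_v f).
Proof.
move=> sf s x Ux; have := sf (rcons s v) x Ux.
by rewrite -cats1 foldr_cat.
Qed.

End SmoothOn.

Section Chart.
Context {R : realType} {n : nat}.
Notation V := 'rV[R]_n.+1.
Implicit Types (M U : set V) (eta : V -> V) (f : V -> R) (p q v w : V).

Definition local_equation M U f p :=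
  [/\ open U, U p, smooth_on U f & M `&` U = [set q | f q = 0] `&` U].

(** The tangent space of a regular level set contains the whole kernel of the
    differential: the curve is the one of [level_set_curve], with the gradient
    as transversal direction. *)
Lemma kernel_tangent M U f q w : local_equation M U f q -> M q ->
  grad f q != 0 -> 'D_w f q = 0 -> tangent_space M q w.
Proof.
move=> [Uo Uq sf MU] Mq G0 fw.
have df x : U x -> differentiable f x by exact: smooth_on_differentiable.
have dDf v x : U x -> differentiable ('D_v f) x.
  by apply: smooth_on_differentiable; exact: smooth_on_derive.
have G1 : 'D_(grad f q) f q != 0 by rewrite -dot_grad ?dot_eq0//; exact: df.
have [s sP] := level_set_curve Uo Uq MU df (dDf w q Uq)
  (differentiable_continuous (dDf (grad f q) q Uq)) Mq fw G1.
have Ps := sP 1 ltr01; move: Ps; set k := _ / 2 => Ps.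
have ds : is_derive (0 : R) 1 s 0.
  apply: (@is_derive0_quadratic _ _ (`|k| + 1)); near=> t.
  have [//|_] := near Ps t.
  rewrite mul1r => st.
  rewrite -(subrK (k * t ^+ 2) (s t)) (le_trans (ler_normD _ _))//.
  by rewrite mulrDl mul1r addrC lerD// normrM [ `|t ^+ 2|]ger0_norm ?sqr_ge0.
exists (fun t => q + t *: w + s t *: grad f q); split.
- have [_] := nbhs_singleton Ps; rewrite expr0n !mulr0 subr0 normr_le0 => /eqP ->.
  by rewrite !scale0r !addr0.
- by apply: filterS Ps => t [].
- have line : is_derive (0 : R) 1 (fun t : R => q + t *: w) w.
    by apply: (is_derive_eq (is_derive_line (f := id) _)) => //; rewrite derive_id.
  apply: (is_derive_eq
    (is_deriveD line (is_derive_scale ds (is_derive_cst (grad f q) (0 : R) (1 : R))))).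
  by rewrite scale0r scaler0 !addr0.
Unshelve. all: by end_near. Qed.

End Chart.

(** * Unit normals and shape operators *)

Section UnitNormal.
Context {R : realType} {n : nat}.
Notation V := 'rV[R]_n.+1.
Implicit Types (M U : set V) (eta : V -> V) (f : V -> R) (p q v w : V).

Lemma unit_normal_differentiable M eta p : unit_normal M eta -> M p ->
  differentiable eta p.
Proof.
by move=> [[U [_ MU se]] _] /MU Up; exact: smooth_on_differentiable se Up.
Qed.

Lemma unit_normal_differentiableD M eta p v : unit_normal M eta -> M p ->
  differentiable ('D_v eta) p.
Proof.
move=> [[U [_ MU se]] _] /MU Up.
exact: smooth_on_differentiable (smooth_on_derive v se) Up.
Qed.

Lemma unit_normal_near_differentiable M eta p : unit_normal M eta -> M p ->
  \forall q \near p, differentiable eta q.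
Proof.
move=> [[U [Uo MU se]] _] /MU Up.
apply: filterS (open_nbhs_nbhs (conj Uo Up)) => q Uq.
exact: smooth_on_differentiable se Uq.
Qed.

Lemma unit_normal_dot M eta p : unit_normal M eta -> M p ->
  dot (eta p) (eta p) = 1.
Proof. by move=> [_ h] /h []. Qed.

(** A derivative in a tangent direction depends only on the values on [M]. *)
Lemma derive_on_curve (W : normedModType R) M (F G : V -> W) p v :
  tangent_space M p v -> differentiable F p -> differentiable G p ->
  (\forall q \near p, M q -> F q = G q) -> 'D_v F p = 'D_v G p.
Proof.
move=> [g [g0 Mg dg]] dF dG FG.
rewrite -g0 in dF dG *.
have [_ <-] := is_derive_curve dg dF; have [_ <-] := is_derive_curve dg dG.
apply: near_eq_derive.
have cg : {for 0, continuous g}.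
  by apply/differentiable_continuous/derivable1_diffP; case: dg.
rewrite -g0 in FG; have := cg _ FG; rewrite nbhs_filterE /= => FG'.
near=> t; have Mt : M (g t) by near: t.
have FGt : M (g t) -> F (g t) = G (g t) by near: t.
exact: FGt.
Unshelve. all: by end_near. Qed.

(** Both vectors are orthogonal to the kernel of the differential of [f], so
    they are parallel.  The equation is free of division, so that both sides
    can be differentiated along [M]. *)
Lemma normal_grad M eta U f q w : unit_normal M eta -> local_equation M U f q ->
  M q -> grad f q != 0 ->
  dot (grad f q) (grad f q) * dot (eta q) w = dot (eta q) (grad f q) * 'D_w f q.
Proof.
move=> ueta leq Mq G0; have [_ Uq sf _] := leq.
have df : differentiable f q by exact: smooth_on_differentiable sf Uq.
have G2 := dot_gt0 G0.
set G := grad f q in G0 G2 *.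
have ker v : dot G v = 0 -> dot (eta q) v = 0.
  rewrite dot_grad// => /(kernel_tangent leq Mq G0).
  by have [_ /(_ _ Mq) [_]] := ueta; apply.
set x := dot G G *: eta q - dot (eta q) G *: G.
have Gx : dot G x = 0 by rewrite !dotE [dot G (eta q)]dotC; ring.
have /eqP : dot x x = 0.
  by rewrite {1}/x dotDl dotNl !dotZl Gx ker// !mulr0 subr0.
rewrite dot_eq0 subr_eq0 => /eqP x0.
by rewrite -dotZl x0 dotZl dot_grad.
Qed.

(** A local equation with its differential normalised by the unit normal; the
    second fundamental form is minus the Hessian of the equation, divided by
    the signed length [l] of its gradient. *)
Lemma unit_normal_chart M eta p : embedded_hypersurface M -> unit_normal M eta ->
  M p -> exists (U : set V) (f : V -> R) (l : R),
  [/\ local_equation M U f p, l != 0, forall v, 'D_v f p = l * dot (eta p) v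
    & forall v w, dot (eta p) v = 0 -> dot (eta p) w = 0 ->
        dot (shape_operator eta p v) w = - (l^-1 * 'D_v ('D_w f) p)].
Proof.
move=> hM ueta Mp; have [U [f [Uo Up sf [v0 fv0] MU]]] := hM p Mp.
have leq q : U q -> local_equation M U f q by [].
have df q : U q -> differentiable f q by exact: smooth_on_differentiable.
have dDf v q : U q -> differentiable ('D_v f) q.
  by apply: smooth_on_differentiable; exact: smooth_on_derive.
have G0 : grad f p != 0.
  apply: contra_neq fv0 => G0.
  by rewrite -dot_grad ?G0 ?dot0l//; exact: df.
have NG w := normal_grad w ueta (leq p Up) Mp G0.
have e1 := unit_normal_dot ueta Mp.
set l := dot (eta p) (grad f p).
have l2 : dot (grad f p) (grad f p) = l ^+ 2.
  by have := NG (eta p); rewrite e1 mulr1 -dot_grad ?[dot (grad _ _) (eta _)]dotC//; exact: df.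
have l0 : l != 0.
  by have := dot_gt0 G0; rewrite l2; apply: contraTneq => ->; rewrite expr0n ltxx.
have Dl v : 'D_v f p = l * dot (eta p) v.
  by apply: (mulfI l0); rewrite -NG l2; ring.
exists U, f, l; split => // v w ev ew.
have fv : 'D_v f p = 0 by rewrite Dl ev mulr0.
have fw : 'D_w f p = 0 by rewrite Dl ew mulr0.
have tv := kernel_tangent (leq p Up) Mp G0 fv.
have deta := unit_normal_differentiable ueta Mp.
have dG : differentiable (grad f) p by apply: differentiable_grad => u; exact: dDf.
have dGG := differentiable_dot dG dG.
have dew := differentiable_dot deta (differentiable_cst w p).
have deG := differentiable_dot deta dG.
have : 'D_v (fun q => dot (grad f q) (grad f q) * dot (eta q) w) p =
       'D_v (fun q => dot (eta q) (grad f q) * 'D_w f q) p.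
  apply: (derive_on_curve tv).
  - exact: differentiableM dGG dew.
  - by apply: differentiableM deG _; exact: dDf.
  - near=> q => Mq; apply: (normal_grad w ueta (leq q _) Mq).
      by near: q; exact: open_nbhs_nbhs.
    near: q; have /= := differentiable_continuous dG.
    by move=> /cvgr_neq0; apply.
rewrite (deriveM (@diff_derivable _ _ _ _ _ v dGG) (@diff_derivable _ _ _ _ _ v dew)).
rewrite (deriveM (@diff_derivable _ _ _ _ _ v deG) (@diff_derivable _ _ _ _ _ v (dDf w p Up))).
rewrite /= ew fw !scale0r !addr0 l2 /GRing.scale/= -/l.
rewrite derive_dotl; last exact: diff_derivable.
move=> H; rewrite /shape_operator dotNl; congr (- _).
apply: (mulfI l0); rewrite mulVKf//; apply: (mulfI l0).
by rewrite -H; ring.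
Unshelve. all: by end_near. Qed.

Lemma tangent_spaceP M eta p v : embedded_hypersurface M -> unit_normal M eta ->
  M p -> tangent_space M p v <-> dot (eta p) v = 0.
Proof.
move=> hM ueta Mp; split; first by have [_ /(_ _ Mp) [_]] := ueta; apply.
have [U [f [l [leq l0 Dl _]]]] := unit_normal_chart hM ueta Mp.
move=> ev; apply: (kernel_tangent leq Mp); last by rewrite Dl ev mulr0.
have [_ Up sf _] := leq; have df := smooth_on_differentiable sf Up.
apply: contra_neq l0 => G0.
by rewrite -[l]mulr1 -(unit_normal_dot ueta Mp) -Dl -dot_grad// G0 dot0l.
Qed.

Lemma shape_operator_sym M eta p v w : embedded_hypersurface M ->
  unit_normal M eta -> M p -> dot (eta p) v = 0 -> dot (eta p) w = 0 ->
  dot (shape_operator eta p v) w = dot (shape_operator eta p w) v.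
Proof.
move=> hM ueta Mp ev ew.
have [U [f [l [[Uo Up sf _] l0 Dl Bl]]]] := unit_normal_chart hM ueta Mp.
have df x : U x -> differentiable f x by exact: smooth_on_differentiable.
have dDf u : differentiable ('D_u f) p.
  exact: smooth_on_differentiable (smooth_on_derive u sf) Up.
have S := derive_sym Uo Up df (dDf w) (dDf v).
apply: (etrans (Bl v w ev ew)); apply/esym/(etrans (Bl w v ew ev)).
by rewrite S.
Qed.

Lemma shape_operator_tangent M eta p v : embedded_hypersurface M ->
  unit_normal M eta -> M p -> dot (eta p) v = 0 ->
  dot (eta p) (shape_operator eta p v) = 0.
Proof.
move=> hM ueta Mp /(tangent_spaceP v hM ueta Mp) tv.
have deta := unit_normal_differentiable ueta Mp.
have : 'D_v (fun q => dot (eta q) (eta q)) p = 'D_v (cst (1 : R)) p.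
  apply: (derive_on_curve tv) => //; first exact: differentiable_dot.
  by near=> q => /(unit_normal_dot ueta).
have /derivableP de := @diff_derivable _ _ _ _ _ v deta.
have [_ ->] := is_derive_dot de de.
rewrite derive_cst [dot _ (eta p)]dotC -mulr2n => /eqP.
by rewrite mulrn_eq0/= /shape_operator dotNr => /eqP ->; rewrite oppr0.
Unshelve. all: by end_near. Qed.

(** A curve in [M] with a given tangent velocity: its normal acceleration is
    the second fundamental form. *)
Lemma tangent_curve M eta p v : embedded_hypersurface M -> unit_normal M eta ->
  M p -> dot (eta p) v = 0 -> exists s : R -> R, forall e : R, 0 < e ->
  \forall t \near (0 : R), M (p + t *: v + s t *: eta p) /\
    `|s t - dot (shape_operator eta p v) v / 2 * t ^+ 2| <= e * t ^+ 2.
Proof.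
move=> hM ueta Mp ev.
have [U [f [l [[Uo Up sf MU] l0 Dl Bl]]]] := unit_normal_chart hM ueta Mp.
have dDf w : differentiable ('D_w f) p.
  exact: smooth_on_differentiable (smooth_on_derive _ sf) Up.
have De : 'D_(eta p) f p = l by rewrite Dl (unit_normal_dot ueta Mp) mulr1.
have [||||s sP] := @level_set_curve _ _ M U f p v (eta p) Uo Up MU _ (dDf v) _ Mp.
- by move=> x; exact: smooth_on_differentiable.
- exact: differentiable_continuous.
- by rewrite Dl ev mulr0.
- by rewrite De.
exists s => e e0; have := sP e e0.
by rewrite Bl// De mulNr [_^-1 * _]mulrC.
Qed.

End UnitNormal.

(** * The Gauss equation *)

Section GaussEquation.
Context {R : realType} {n : nat}.
Notation V := 'rV[R]_n.+1.
Variables (M : set V) (eta : V -> V) (p : V).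
Hypotheses (hM : embedded_hypersurface M) (ueta : unit_normal M eta) (Mp : M p).
Implicit Types (q v w x y z : V).

Lemma tprojD q v w : tproj eta q (v + w) = tproj eta q v + tproj eta q w.
Proof. by rewrite /tproj dotDl scalerDl opprD addrACA. Qed.

Lemma tprojZ q k v : tproj eta q (k *: v) = k *: tproj eta q v.
Proof. by rewrite /tproj dotZl scalerBr scalerA. Qed.

Lemma tproj_normal : tproj eta p (eta p) = 0.
Proof. by rewrite /tproj (unit_normal_dot ueta Mp) scale1r subrr. Qed.

Lemma tproj_id v : dot (eta p) v = 0 -> tproj eta p v = v.
Proof. by rewrite /tproj dotC => ->; rewrite scale0r subr0. Qed.

Lemma dot_normal_tproj v : dot (eta p) (tproj eta p v) = 0.
Proof.
by rewrite /tproj !dotE (unit_normal_dot ueta Mp) mulr1 dotC subrr.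
Qed.

Lemma is_derive_tproj q v z : differentiable eta q ->
  is_derive q v (fun q => tproj eta q z)
    (- (dot z (eta q) *: 'D_v eta q + dot z ('D_v eta q) *: eta q)).
Proof.
move=> de; have dv := is_derive_diff v de.
have dz := is_derive_dot (is_derive_cst z q v) dv.
have ds := is_derive_scale dz dv.
apply: (is_derive_eq (is_deriveB (is_derive_cst z q v) ds)).
by rewrite sub0r dot0l add0r.
Qed.

Lemma derive_shape v : 'D_v eta p = - shape_operator eta p v.
Proof. by rewrite /shape_operator opprK. Qed.

(** The derivative of a projected constant field is a combination of the
    normal and of the derivative of the normal; at [p] the coefficient of the
    latter vanishes, and the tangential projection discards the former. *)
Lemma nabla_nabla_tproj x y z : dot (eta p) x = 0 -> dot (eta p) y = 0 ->
  dot (eta p) z = 0 ->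
  nabla eta (fun q => tproj eta q x)
    (nabla eta (fun q => tproj eta q y) (fun q => tproj eta q z)) p =
  - dot (shape_operator eta p x) z *: shape_operator eta p y.
Proof.
move=> ex ey ez; rewrite {1}/nabla (tproj_id ex).
have de := unit_normal_differentiable ueta Mp.
have dx := is_derive_diff x de.
pose L q := \sum_(i < n.+1) dot (tproj eta q y) (delta_mx 0 i) *:
  'D_(delta_mx 0 i) eta q.
have dL : derivable L p x.
  rewrite (_ : L = \sum_(i < n.+1) (fun q => dot (tproj eta q y) (delta_mx 0 i)
      *: 'D_(delta_mx 0 i) eta q)); last first.
    by apply/funext => q; rewrite fct_sumE.
  apply: derivable_sum => i.
  have dD := is_derive_diff x (unit_normal_differentiableD (delta_mx 0 i) ueta Mp).
  have dY := is_derive_dot (is_derive_tproj x y de)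
    (is_derive_cst (delta_mx 0 i) p x).
  by case: (is_derive_scale dY dD).
pose b q := - dot z (eta q).
pose k q := - dot z (L q) * (1 - dot (eta q) (eta q)) - b q * dot (L q) (eta q).
have near_nabla : \forall q \near p, k q *: eta q + b q *: L q =
    nabla eta (fun q => tproj eta q y) (fun q => tproj eta q z) q.
  apply: filterS (unit_normal_near_differentiable ueta Mp) => q dq.
  rewrite /nabla; have [_ ->] := is_derive_tproj (tproj eta q y) z dq.
  rewrite (derive_basis _ dq) -/(L q) /k /b; move: (L q) => l.
  apply/rowP => i; rewrite /tproj !dotE !mxE; ring.
have /derivableP dLx := dL.
have cz := is_derive_cst z p x.
have [dk dkx] : exists dk, is_derive p x k dk.
  eexists; rewrite /k /b.
  exact: (is_deriveB
    (is_deriveM (is_deriveN (is_derive_dot cz dLx))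
      (is_deriveB (is_derive_cst (1 : R) p x) (is_derive_dot dx dx)))
    (is_deriveM (is_deriveN (is_derive_dot cz dx)) (is_derive_dot dLx dx))).
have db : is_derive p x b (- dot z ('D_x eta p)).
  apply: (is_derive_eq (is_deriveN (is_derive_dot cz dx))).
  by rewrite dot0l add0r.
have dN := is_deriveD (is_derive_scale dkx dx) (is_derive_scale db dLx).
have [_ ->] := near_eq_is_derive near_nabla dN.
have b0 : b p = 0 by rewrite /b dotC ez oppr0.
have k0 : k p = 0 by rewrite /k b0 (unit_normal_dot ueta Mp) subrr mulr0 mul0r subr0.
have Lp : L p = 'D_y eta p by rewrite (derive_basis _ de) /L (tproj_id ey).
rewrite b0 k0 !scale0r !add0r Lp tprojD !tprojZ tproj_normal scaler0 add0r.
rewrite !derive_shape dotNr opprK.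
rewrite -tprojZ scalerN -scaleNr tprojZ dotC tproj_id//.
exact: shape_operator_tangent hM ueta Mp ey.
Qed.

Lemma nabla_tproj_eq0 W z : dot (eta p) z = 0 ->
  nabla eta W (fun q => tproj eta q z) p = 0.
Proof.
move=> ez; have de := unit_normal_differentiable ueta Mp.
rewrite /nabla; have [_ ->] := is_derive_tproj (W p) z de.
by rewrite [dot z _]dotC ez scale0r add0r -scaleNr tprojZ tproj_normal scaler0.
Qed.

Lemma riemann_curvatureE x y z : dot (eta p) x = 0 -> dot (eta p) y = 0 ->
  dot (eta p) z = 0 ->
  riemann_curvature eta p x y z =
    dot (shape_operator eta p y) z *: shape_operator eta p x
    - dot (shape_operator eta p x) z *: shape_operator eta p y.
Proof.
move=> ex ey ez; rewrite /riemann_curvature; cbv zeta.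
set W := lie_bracket _ _.
rewrite (nabla_nabla_tproj ex ey ez) (nabla_nabla_tproj ey ex ez).
rewrite (nabla_tproj_eq0 W ez).
have alg (k l : R) (u v : V) : - k *: u - - l *: v - 0 = l *: v - k *: u.
  by rewrite subr0 !scaleNr opprK addrC.
exact: alg.
Qed.

Let E i := tproj eta p (delta_mx 0 i).
Let A := shape_operator eta p.

Lemma trace_shape_operator : n != 0%N ->
  \sum_i dot (A (E i)) (E i) = n%:R * mean_curvature eta p.
Proof.
by move=> n0; rewrite mulrC /mean_curvature /ttrace divfK// pnatr_eq0.
Qed.

(** Two traces of [riemann_curvatureE]; the symmetry of the shape operator makes
    the subtracted term a sum of squares. *)
Lemma gauss_equation : n != 0%N ->
  \sum_i \sum_j dot (A (E i)) (E j) ^+ 2 =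
  (n%:R * mean_curvature eta p) ^+ 2 - scalar_curvature eta p.
Proof.
move=> n0; have eE i : dot (eta p) (E i) = 0 by exact: dot_normal_tproj.
have -> : scalar_curvature eta p = \sum_j \sum_i
    (dot (A (E j)) (E j) * dot (A (E i)) (E i) - dot (A (E j)) (E i) ^+ 2).
  rewrite /scalar_curvature /ricci_curvature /ttrace.
  apply: eq_bigr => j _; apply: eq_bigr => i _; cbv zeta beta.
  rewrite -/(E j) -/(E i).
  have Rm := riemann_curvatureE (eE i) (eE j) (eE j).
  have sym := shape_operator_sym hM ueta Mp (eE i) (eE j).
  have alg (k l : R) (u v w : V) : l = dot v w ->
      dot (k *: u - l *: v) w = k * dot u w - dot v w ^+ 2.
    by move=> ->; rewrite !dotE expr2.
  by rewrite Rm; exact: (alg _ _ _ _ _ sym).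
have alg (b : 'I_n.+1 -> R) (a : 'I_n.+1 -> 'I_n.+1 -> R) :
    \sum_i \sum_j a i j ^+ 2 =
    (\sum_i b i) ^+ 2 - \sum_j \sum_i (b j * b i - a j i ^+ 2).
  rewrite expr2 mulr_suml.
  under [X in _ - X]eq_bigr do rewrite sumrB -mulr_sumr.
  by rewrite sumrB opprB addrC subrK.
by rewrite -trace_shape_operator//; exact: alg.
Qed.

(** A second fundamental form is bounded by its Hilbert-Schmidt norm. *)
Lemma shape_operator_bound S v : n != 0%N ->
  (n%:R * mean_curvature eta p) ^+ 2 - scalar_curvature eta p <= S ^+ 2 ->
  0 <= S -> dot (eta p) v = 0 -> `|dot (A v) v| <= S * dot v v.
Proof.
move=> n0 S2 S0 ev.
pose a i : V := \row_j dot (A (E i)) (E j).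
pose c : V := \row_i dot (a i) v.
have vE : v = \sum_i v 0 i *: E i.
  rewrite -{1}(tproj_id ev) {1}(row_sum_delta v) /tproj dot_suml scaler_suml -sumrB.
  by apply: eq_bigr => i _; rewrite /E /tproj dotZl scalerBr scalerA.
have lin w : dot (A v) w = \sum_i v 0 i * dot (A (E i)) w.
  rewrite /A /shape_operator [in LHS]vE.
  rewrite derive_sumv; last exact: unit_normal_differentiable ueta Mp.
  rewrite -sumrN dot_suml; apply: eq_bigr => i _.
  rewrite deriveZv; last exact: unit_normal_differentiable ueta Mp.
  by rewrite -scalerN dotZl.
have -> : dot (A v) v = dot v c.
  rewrite lin; apply: eq_bigr => i _; congr (_ * _); rewrite mxE.
  rewrite [in LHS]vE dotC dot_suml; apply: eq_bigr => j _.
  by rewrite dotZl !mxE mulrC [dot (E j) _]dotC.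
have c2 : dot c c <= dot v v * S ^+ 2.
  rewrite (@le_trans _ _ (dot v v * \sum_i \sum_j dot (A (E i)) (E j) ^+ 2))//.
    rewrite mulr_sumr; apply: ler_sum => i _; rewrite mxE -expr2.
    apply: le_trans (dot_CS _ _) _; rewrite mulrC ler_wpM2l ?dot_ge0//.
    by apply: ler_sum => j _; rewrite !mxE -expr2.
  by rewrite ler_wpM2l ?dot_ge0// gauss_equation.
rewrite -(ler_pXn2r (n := 2))// ?nnegrE ?mulr_ge0 ?dot_ge0//.
rewrite real_normK ?num_real// (le_trans (dot_CS _ _))//.
rewrite (_ : (S * _) ^+ 2 = dot v v * (dot v v * S ^+ 2)); last by ring.
by rewrite ler_wpM2l// dot_ge0.
Qed.

End GaussEquation.

(** * Components of the complement of a level set *)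

Section Sides.
Context {R : realType} {V : normedModType R}.
Implicit Types (A M U C : set V) (f : V -> R) (p q u v x y a : V).

Lemma component_segment A x y :
  (forall t : R, 0 <= t <= 1 -> A (x + t *: (y - x))) ->
  connected_component A x y.
Proof.
move=> Axy; pose g (t : R) := x + t *: (y - x).
have cg : continuous g.
  move=> t; apply: differentiable_continuous; apply/derivable1_diffP.
  by case: (@is_derive_line _ _ _ id x (y - x) t _).
have Bc : connected (g @` `[0, 1]).
  apply: connected_continuous_connected; first exact: segment_connected.
  exact: continuous_subspaceT.
apply: (connected_component_max _ _ Bc).
- by exists 0; rewrite /g/= ?in_itv/= ?lexx ?ler01// scale0r addr0.
- by move=> _ [t /= t01 <-]; apply: Axy; move: t01; rewrite in_itv.
- by exists 1; rewrite /g/= ?in_itv/= ?lexx ?ler01// scale1r addrC subrK.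
Qed.

Lemma component_ball A q y r : (forall h, `|h| < r -> A (q + h)) ->
  `|y - q| < r -> connected_component A q y.
Proof.
move=> Ar yr; apply: component_segment => t /andP[t0 t1].
apply: Ar; rewrite normrZ ger0_norm// (le_lt_trans _ yr)//.
by rewrite -[leRHS]mul1r ler_wpM2r.
Qed.

Lemma open_norm A p : open A -> A p ->
  exists2 r : R, 0 < r & forall h, `|h| < r -> A (p + h).
Proof.
move=> Ao Ap; have /nbhs_normP[d /= d0 H] := open_nbhs_nbhs (conj Ao Ap).
by exists d => // h hd; apply: H; rewrite /= opprD addNKr normrN.
Qed.

Lemma open_component A x : open A -> open (connected_component A x).
Proof.
move=> Ao; rewrite openE => y xy; rewrite /interior.
have Ay := connected_component_sub xy.
have [r r0 Ar] := open_norm Ao Ay.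
apply/nbhs_normP; exists r => //= z /=; rewrite distrC => zr.
exact: connected_component_trans xy (component_ball Ar zr).
Qed.

Lemma connected_setT : connected [set: V].
Proof.
have <- : connected_component [set: V] 0 = [set: V].
  by apply/seteqP; split => // y _; exact: component_segment.
exact: component_connected.
Qed.

(** Near a point of a level set [f = 0] with [f] increasing along [a], the
    part [f > 0] lies in one component of the complement: push along [a]
    until a ball around [p + s a] is reached. *)
Lemma positive_side M f p a (r : R) : 0 < r -> f p = 0 ->
  (forall q, `|q - p| < r -> f q != 0 -> ~ M q) ->
  (forall q, `|q - p| < r -> differentiable f q) ->
  (forall q, `|q - p| < r -> 0 < 'D_a f q) ->
  exists2 r' : R, 0 < r' & forall y z, `|y - p| < r' -> `|z - p| < r' ->
    0 < f y -> 0 < f z -> connected_component (~` M) y z.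
Proof.
move=> r0 fp MU df Da.
pose U q := `|q - p| < r.
have Ur h : `|h| < r -> U (p + h) by rewrite /U [p + h]addrC addrK.
pose s := r / 2 / (`|a| + 1).
have a1 : 0 < `|a| + 1 by rewrite ltr_wpDl.
have s0 : 0 < s by rewrite !divr_gt0.
have sa t : 0 <= t -> t <= s -> `|t *: a| < r / 2.
  move=> t0 ts; rewrite normrZ ger0_norm//.
  apply: (@lt_le_trans _ _ (s * (`|a| + 1))); last by rewrite /s divfK// gt_eqF.
  apply: (@le_lt_trans _ _ (s * `|a|)); first by rewrite ler_wpM2r.
  by rewrite ltr_pM2l// ltrDl.
have r2 : r / 2 + r / 2 = r by rewrite -splitr.
have Uline y t : `|y - p| < r / 2 -> 0 <= t -> t <= s -> U (y + t *: a).
  move=> yp t0 ts; rewrite -(subrK p y) addrAC [X in U X]addrC; apply: Ur.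
  by rewrite (le_lt_trans (ler_normD _ _))// -r2 ltrD// sa.
have incr y t : `|y - p| < r / 2 -> 0 <= t -> t <= s ->
    exists2 d : R, 0 < d & f (y + t *: a) = f y + d * t.
  move=> yp t0 ts.
  have t0' := t0; rewrite le_eqVlt in t0'; case/orP: t0' => [/eqP <-|tpos].
    by exists 1 => //; rewrite scale0r addr0 mulr0 addr0.
  have itv (b : R) : b \in `[0, t]%R -> U (y + b *: a).
    by rewrite in_itv/= => /andP[b0 bt]; apply: Uline => //; exact: le_trans ts.
  have [||c c0t E] := @MVT R (fun b => f (y + b *: a))
      (fun b => 'D_a f (y + b *: a)) 0 t tpos.
  - move=> b b0t; apply: is_derive_line; apply: df; apply: itv.
    exact: subset_itv_oo_cc.
  - apply: derivable_within_continuous => b /itv /df fb.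
    by case: (is_derive_line fb).
  exists ('D_a f (y + c *: a)); first by apply: Da; apply: itv; exact: subset_itv_oo_cc.
  by move: E; rewrite scale0r addr0 subr0 => <-; rewrite [RHS]addrC subrK.
have [e e0 fe] : exists2 e : R, 0 < e & forall h, `|h| < e -> 0 < f (p + s *: a + h).
  have pr : `|p - p| < r / 2 by rewrite subrr normr0 divr_gt0.
  have Us := Uline p s pr (ltW s0) (lexx s).
  have fs : 0 < f (p + s *: a).
    have [d d0 ->] := incr p s pr (ltW s0) (lexx s).
    by rewrite fp add0r mulr_gt0.
  have f20 : 0 < f (p + s *: a) / 2 by rewrite divr_gt0.
  have [e e0 H] := continuous_norm (differentiable_continuous (df _ Us)) f20.
  exists e => // h /H; rewrite ler_distl => /andP[+ _].
  apply: lt_le_trans; move: fs; set X := f (p + s *: a); lra.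
exists (Num.min (r / 2) e) => [|y z]; first by rewrite lt_min divr_gt0.
rewrite !lt_min => /andP[yr ye] /andP[zr ze] fy fz.
have up w : `|w - p| < r / 2 -> 0 < f w ->
    connected_component (~` M) w (w + s *: a).
  move=> wr fw; apply: component_segment => t /andP[t0 t1].
  rewrite [w + s *: a]addrC addrK scalerA.
  have ts : t * s <= s by rewrite -[leRHS]mul1r ler_wpM2r// ltW.
  have ts0 : 0 <= t * s by rewrite mulr_ge0// ltW.
  apply: MU; first exact: Uline.
  by have [d d0 ->] := incr w _ wr ts0 ts; rewrite gt_eqF// ltr_wpDr// mulr_ge0// ltW.
apply: connected_component_trans (up y yr fy) _.
apply: connected_component_sym; apply: connected_component_trans (up z zr fz) _.
apply: component_segment => t /andP[t0 t1].
have -> : z + s *: a + t *: (y + s *: a - (z + s *: a)) =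
    p + s *: a + ((1 - t) *: (z - p) + t *: (y - p)).
  have -> : (1 - t) *: (z - p) + t *: (y - p) = z - p + t *: (y - z).
    rewrite scalerBl scale1r -addrA; congr (_ + _).
    by rewrite addrC -scalerBr opprB addrA subrK.
  rewrite [RHS]addrA; congr (_ + _ *: _).
    by rewrite [RHS]addrC addrA subrK.
  by rewrite opprD addrACA subrr addr0.
have conv : `|(1 - t) *: (z - p) + t *: (y - p)| < Num.min (r / 2) e.
  have m : forall w, `|w - p| < r / 2 -> `|w - p| < e -> `|w - p| < Num.min (r / 2) e.
    by move=> w w1 w2; rewrite lt_min w1.
  rewrite (le_lt_trans (ler_normD _ _))// !normrZ !ger0_norm ?subr_ge0//.
  set m0 := Num.min _ _; have Y := m y yr ye; have Z := m z zr ze.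
  have [->|tn0] := eqVneq t 0; first by rewrite subr0 mul1r mul0r addr0.
  have tp : 0 < t by rewrite lt_def tn0.
  rewrite (_ : m0 = (1 - t) * m0 + t * m0); last by ring.
  by rewrite ler_ltD ?ltr_pM2l// ler_wpM2l ?subr_ge0// ltW.
move: conv; rewrite lt_min => /andP[c1 c2].
apply: MU; last by rewrite gt_eqF// fe.
rewrite -/(U _) -addrA; apply: Ur; rewrite (le_lt_trans (ler_normD _ _))// -r2 ltrD// sa//.
by rewrite ltW.
Qed.

End Sides.

(** * The convex side *)

Section ConvexSide.
Context {R : realType} {n : nat}.
Notation V := 'rV[R]_n.+1.
Implicit Types (C : set V) (f : V -> R) (p q u v y z : V).
Variables (M : set V) (eta : V -> V).
Hypotheses (hM : embedded_hypersurface M) (ueta : unit_normal M eta).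

Lemma two_sides q : M q -> exists (f : V -> R) (l r : R),
  [/\ 0 < r, l != 0,
     forall y, `|y - q| < r ->
       [/\ M y <-> f y = 0, differentiable f y & 0 < 'D_(l *: eta q) f y],
     forall v, 'D_v f q = l * dot (eta q) v
   & forall y z, `|y - q| < r -> `|z - q| < r -> 0 < f y * f z ->
       connected_component (~` M) y z].
Proof.
move=> Mq; have [U [f [l [[Uo Uq sf MU] l0 Dl _]]]] := unit_normal_chart hM ueta Mq.
have df x : U x -> differentiable f x by exact: smooth_on_differentiable.
(* The factor [l] orients [a] so that [f] increases along it. *)
set a := l *: eta q.
have Daq : 0 < 'D_a f q.
  rewrite Dl dotZr (unit_normal_dot ueta Mq) mulr1 -expr2.
  by rewrite lt_def sqrf_eq0 l0 sqr_ge0.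
have cDa : {for q, continuous ('D_a f)}.
  apply: differentiable_continuous.
  exact: smooth_on_differentiable (smooth_on_derive a sf) Uq.
have Daq2 : 0 < 'D_a f q / 2 by rewrite divr_gt0.
have [r1 r10 H1] := open_norm Uo Uq.
have [r2 r20 H2] := continuous_norm cDa Daq2.
have Ur y : `|y - q| < Num.min r1 r2 -> U y.
  by rewrite lt_min => /andP[/H1 + _]; rewrite addrC subrK.
have Dr y : `|y - q| < Num.min r1 r2 -> 0 < 'D_a f y.
  rewrite lt_min => /andP[_ /H2]; rewrite [q + _]addrC subrK.
  rewrite ler_distl => /andP[+ _]; apply: lt_le_trans.
  by move: Daq; set d := 'D_a f q; lra.
have Mr y : `|y - q| < Num.min r1 r2 -> M y <-> f y = 0.
  move=> /Ur Uy; split => [My|fy].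
    by have : (M `&` U) y by []; rewrite MU => -[].
  by have : ([set x | f x = 0] `&` U) y by []; rewrite -MU => -[].
have r0 : 0 < Num.min r1 r2 by rewrite lt_min r10.
have fq : f q = 0 by apply/(Mr q) => //; rewrite subrr normr0.
have Mf y : `|y - q| < Num.min r1 r2 -> f y != 0 -> ~ M y.
  by move=> /Mr H /eqP fy /H.
have dfr y : `|y - q| < Num.min r1 r2 -> differentiable f y by move=> /Ur /df.
have [r3 r30 H3] := positive_side r0 fq Mf dfr Dr.
have [||||r4 r40 H4] := @positive_side _ _ M (- f) q (- a) _ r0.
- by rewrite fctE fq oppr0.
- by move=> y yr; rewrite fctE oppr_eq0; exact: Mf.
- by move=> y /dfr; exact: differentiableN.
- move=> y yr; have dy := dfr y yr.
  rewrite deriveN; last exact: diff_derivable.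
  by rewrite -(scaleN1r a) deriveZv// scaleN1r opprK Dr.
exists f, l, (Num.min (Num.min r1 r2) (Num.min r3 r4)); split => //.
- by rewrite !lt_min r10 r20 r30.
- by move=> y; rewrite lt_min => /andP[yr _]; split; [exact: Mr|exact: dfr|exact: Dr].
- move=> y z; rewrite lt_min => /andP[_]; rewrite lt_min => /andP[y3 y4].
  rewrite lt_min => /andP[_]; rewrite lt_min => /andP[z3 z4].
  have [fy|fy|->] := ltgtP (f y) 0; last by rewrite mul0r ltxx.
    rewrite nmulr_rgt0// => fz.
    by apply: H4 => //; rewrite fctE oppr_gt0.
  by rewrite pmulr_rgt0// => fz; exact: H3.
Qed.

Lemma near_right_line (r : R) v : 0 < r -> \forall t \near (0 : R)^'+, `|t *: v| < r.
Proof.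
move=> r0; near=> t.
have t0 : 0 < t by near: t; exact: nbhs_right_gt.
rewrite normrZ gtr0_norm//.
apply: (@le_lt_trans _ _ (t * (`|v| + 1))); first by rewrite ler_wpM2l ?lerDl// ltW.
rewrite -ltr_pdivlMr ?ltr_wpDl//; near: t; apply: nbhs_right_lt.
by rewrite divr_gt0// ltr_wpDl.
Unshelve. all: by end_near. Qed.

Lemma near_right_sign f q v : differentiable f q -> f q = 0 -> 'D_v f q != 0 ->
  \forall t \near (0 : R)^'+, 0 < f (q + t *: v) * 'D_v f q.
Proof.
move=> df fq Dv; set D := 'D_v f q in Dv *.
have D0 : 0 < `|D| by rewrite normr_gt0.
have v1 : 0 < `|v| + 1 by rewrite ltr_wpDl.
have e0 : 0 < `|D| / (2 * (`|v| + 1)) by rewrite divr_gt0 ?mulr_gt0.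
have [d d0 H] := differentiable_expansion df e0.
near=> t.
have t0 : 0 < t by near: t; exact: nbhs_right_gt.
have td : `|t *: v| < d by near: t; exact: near_right_line.
have := H _ td; rewrite fq subr0 deriveZv// normrZ gtr0_norm// -/D => K.
have {}K : `|f (q + t *: v) - t * D| <= t * `|D| / 2.
  apply: le_trans K _.
  rewrite (_ : _ * (t * _) = t * `|D| / 2 * (`|v| / (`|v| + 1))); last first.
    by field; rewrite gt_eqF.
  rewrite -[leRHS]mulr1 ler_wpM2l//; first by rewrite !mulr_ge0// ltW.
  by rewrite ler_pdivrMr// mul1r lerDl.
have tD2 : 0 < t * D ^+ 2 / 2.
  by rewrite divr_gt0// mulr_gt0// -(real_normK (num_real D)) exprn_gt0.
move: K; move: (f _) => x K.
have : `|(x - t * D) * D| <= t * D ^+ 2 / 2.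
  rewrite normrM -(real_normK (num_real D)).
  rewrite (_ : t * `|D| ^+ 2 / 2 = t * `|D| / 2 * `|D|); last by ring.
  by rewrite ler_wpM2r.
rewrite ler_norml => /andP[+ _].
by move: tD2; rewrite (_ : (x - t * D) * D = x * D - t * D ^+ 2); [lra|ring].
Unshelve. all: by end_near. Qed.

Hypotheses (cM : connected M) (clM : closed M).

(** If the convex side could be entered from [p] against the normal, it would
    contain both sides of [M] near [p]; the set of such points is open and
    closed in [M], so [M] together with its convex side would be open and
    closed in the whole space. *)
Lemma convex_side_direction C p u :
  (forall q, M q -> 0 < mean_curvature eta q) -> is_convex_side M eta C ->
  M p -> (\forall t \near (0 : R)^'+, C (p + t *: u)) -> 0 <= dot (eta p) u.
Proof.
move=> H0 [[a [b [Ma Mb CE Cb Cab]]] HC] Mp Cu.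
have oM : open (~` M) by exact: closed_openC.
have oC : open C by rewrite CE; exact: open_component.
have CM y : C y -> ~ M y by rewrite CE => /connected_component_sub.
have Ccc y z : C y -> connected_component (~` M) y z -> C z.
  by rewrite CE => ay yz; exact: connected_component_trans ay yz.
pose S : set V := [set y | M y \/ C y].
have both q f l r y z : M q -> (forall y, `|y - q| < r ->
       [/\ M y <-> f y = 0, differentiable f y & 0 < 'D_(l *: eta q) f y]) ->
     (forall y z, `|y - q| < r -> `|z - q| < r -> 0 < f y * f z ->
       connected_component (~` M) y z) -> 0 < r ->
     `|y - q| < r -> `|z - q| < r -> C y -> C z -> f y * f z < 0 -> S° q.
  move=> Mq Hq cc r0 yr zr Cy Cz yz; change (nbhs q S).
  apply/(@nbhs_normP R V q S); exists r => //= x /=; rewrite distrC => xr.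
  have [Mx|Mx] := pselect (M x); first by left.
  right; have [Mfx _ _] := Hq x xr.
  have fx : f x != 0 by apply/eqP => /Mfx.
  have [xy|xy] := ltP 0 (f y * f x); first exact: Ccc Cy (cc _ _ yr xr xy).
  apply: Ccc Cz (cc _ _ zr xr _).
  have fy : f y != 0 by apply: contraTneq yz => ->; rewrite mul0r ltxx.
  have fy2 : 0 < f y ^+ 2 by rewrite lt_def sqrf_eq0 fy sqr_ge0.
  have xy' : f y * f x < 0 by rewrite lt_neqAle xy mulf_neq0.
  rewrite -(pmulr_rgt0 _ fy2).
  rewrite [ltRHS](_ : _ = (f y * f z) * (f y * f x)); last by ring.
  by rewrite nmulr_rgt0.
rewrite leNgt; apply/negP => eu.
have Sp : S° p.
  have [f [l [r [r0 l0 Hp Dl cc]]]] := two_sides Mp.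
  have pr : `|p - p| < r by rewrite subrr normr0.
  have [Mfp dfp _] := Hp p pr.
  have fp : f p = 0 by apply/Mfp.
  have De : 'D_(mean_curvature_vector eta p) f p = l * mean_curvature eta p.
    by rewrite Dl dotZr (unit_normal_dot ueta Mp) mulr1.
  have De0 : 'D_(mean_curvature_vector eta p) f p != 0.
    by rewrite De mulf_neq0// gt_eqF// H0.
  have Du0 : 'D_u f p != 0 by rewrite Dl mulf_neq0// lt_eqF.
  have N1 := near_right_sign dfp fp De0.
  have N2 := near_right_sign dfp fp Du0.
  have N3 := HC p Mp.
  have N4 := near_right_line (mean_curvature_vector eta p) r0.
  have N5 := near_right_line u r0.
  have [t [] [] [] [] [t1 t2] t3 t4 t5 t6] := @filter_ex _ _ _ _
    (filterI (filterI (filterI (filterI (filterI N1 N2) N3) N4) N5) Cu).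
  apply: (both p f l r _ _ Mp Hp cc r0 _ _ t3 t6); rewrite ?[p + _]addrC ?addrK//.
  move: t1 t2; rewrite De Dl; have := H0 p Mp.
  rewrite ![p + _]addrC; move: (f _) (f _) (mean_curvature _ _) (dot _ _) eu.
  move=> x1 x2 h d d0 h0 A B.
  have l2 : 0 < l ^+ 2 by rewrite lt_def sqrf_eq0 l0 sqr_ge0.
  have K : 0 < l ^+ 2 * h by rewrite mulr_gt0.
  have K2 : l ^+ 2 * h * d < 0 by rewrite pmulr_rlt0.
  rewrite -(nmulr_lgt0 _ K2).
  rewrite [ltRHS](_ : _ = x2 * (l * h) * (x1 * (l * d))); last by ring.
  exact: mulr_gt0.
have TM : M `&` S° = M.
  apply: cM.
  - by exists p.
  - by exists S° => //; exact: open_interior.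
  - exists (closure (M `&` S°)); first exact: closed_closure.
    apply/seteqP; split => q [Mq Sq]; split => //; first exact: subset_closure.
    have [f [l [r [r0 l0 Hq Dl cc]]]] := two_sides Mq.
    have [q' [[Mq' Sq'] q'r]] : (M `&` S°) `&` [set y | `|y - q| < r] !=set0.
      apply: Sq; apply/(@nbhs_normP R V q [set y | `|y - q| < r]).
      by exists r => //= y /=; rewrite distrC.
    have [Mfq' dfq' Dq'] := Hq q' q'r.
    have fq' : f q' = 0 by apply/Mfq'.
    set w := l *: eta q in Hq Dq'.
    have Dn : 'D_(- w) f q' = - 'D_w f q' by rewrite -(scaleN1r w) deriveZv// scaleN1r.
    have N1 := near_right_sign dfq' fq' (lt0r_neq0 Dq').
    have N2 : \forall t \near (0 : R)^'+, 0 < f (q' + t *: - w) * 'D_(- w) f q'.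
      by apply: near_right_sign => //; rewrite Dn oppr_eq0 lt0r_neq0.
    have [e e0 He] := open_norm (@open_interior _ S) Sq'.
    have e'0 : 0 < Num.min e (r - `|q' - q|) by rewrite lt_min e0 subr_gt0.
    have N3 := near_right_line w e'0.
    have [t [] [t1 t2]] := @filter_ex _ _ _ _ (filterI (filterI N1 N2) N3).
    rewrite lt_min => /andP[te tr].
    have te' : `|t *: - w| < e by rewrite scalerN normrN.
    have tr' : `|t *: - w| < r - `|q' - q| by rewrite scalerN normrN.
    move: t1 t2; rewrite Dn mulrN oppr_gt0 pmulr_lgt0// pmulr_llt0// => t1 t2.
    have inr h : `|h| < r - `|q' - q| -> `|q' + h - q| < r.
      move=> hr; rewrite addrAC (le_lt_trans (ler_normD _ _))//.
      by rewrite -ltrBrDl.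
    have inC h : `|h| < e -> `|h| < r - `|q' - q| -> f (q' + h) != 0 -> C (q' + h).
      move=> he hr fh; have [Mf _ _] := Hq _ (inr h hr).
      by have [/Mf fh0|//] := interior_subset (He h he); rewrite fh0 eqxx in fh.
    apply: (both q f l r (q' + t *: w) (q' + t *: - w)) => //.
    + exact: inr.
    + exact: inr.
    + by apply: inC => //; rewrite gt_eqF.
    + by apply: inC => //; rewrite lt_eqF.
    + by rewrite pmulr_rlt0.
have oS : open S.
  rewrite openE => y [My|Cy]; first by have [] : (M `&` S°) y by rewrite TM.
  apply: (filterS (P := C)); first by move=> z Cz; right.
  exact: open_nbhs_nbhs.
have cS : closed S.
  rewrite (_ : S = ~` connected_component (~` M) b); last first.
    apply/seteqP; split => y.
      case=> [My /connected_component_sub//|Cy yb].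
      by have : (C `&` connected_component (~` M) b) y by []; rewrite Cb.
    move=> yb; have [My|My] := pselect (M y); [by left|right].
    by have : (~` M) y by []; rewrite -Cab => -[].
  exact/open_closedC/open_component.
have ST : S = [set: V].
  apply: connected_setT; first by exists p; left.
    by exists S => //; rewrite setTI.
  by exists S => //; rewrite setTI.
have : S b by rewrite ST.
case=> // Cbb; have : (C `&` connected_component (~` M) b) b.
  by split => //; exact: connected_component_refl.
by rewrite Cb.
Qed.

End ConvexSide.

(** * Minimising a penalised distance *)

Section Minimisation.
Context {R : realType} {N : nat}.
Notation V := 'rV[R]_N.
Implicit Types (x y p q v w h : V).

(** A smooth proper function of slope less than one; it dominates the norm. *)
Definition bracket (x : V) : R := Num.sqrt (1 + dot x x).

Lemma bracket_gt0 x : 0 < bracket x.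
Proof. by rewrite sqrtr_gt0 ltr_wpDr// dot_ge0. Qed.

Lemma sqr_bracket x : bracket x ^+ 2 = 1 + dot x x.
Proof. by rewrite sqr_sqrtr// addr_ge0// dot_ge0. Qed.

Lemma bracket_ge1 x : 1 <= bracket x.
Proof.
rewrite -(ler_pXn2r (n := 2))// ?nnegrE ?(ltW (bracket_gt0 x))//.
by rewrite sqr_bracket expr1n lerDl dot_ge0.
Qed.

Lemma enorm_le_bracket x : enorm x <= bracket x.
Proof. by rewrite ler_wsqrtr// lerDr. Qed.

Lemma bracket_lipschitz x h : bracket (x + h) <= bracket x + enorm h.
Proof.
have b0 := ltW (bracket_gt0 x).
rewrite -(ler_pXn2r (n := 2))// ?nnegrE ?addr_ge0 ?enorm_ge0 ?(ltW (bracket_gt0 _))//.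
rewrite sqrrD !sqr_bracket sqr_enorm !dotE (dotC h x).
have : dot x h <= bracket x * enorm h.
  rewrite (le_trans (ler_norm _))// (le_trans (ler_dot_enorm _ _))//.
  by rewrite ler_wpM2r ?enorm_ge0// enorm_le_bracket.
by rewrite -mulr_natl; lra.
Qed.

Lemma bracket_le_tangent x y :
  bracket y <= (1 + dot y y + bracket x ^+ 2) / (2 * bracket x).
Proof.
apply: sqrtr_le_tangent (bracket_gt0 x).
by rewrite addr_ge0// dot_ge0.
Qed.

Lemma continuous_dot (T : topologicalType) (F : T -> V) :
  continuous F -> continuous (fun z => dot (F z) (F z)).
Proof.
move=> cF; rewrite /dot.
apply: continuous_big => [|i _]; first exact: add_continuous.
move=> z; have ci : {for z, continuous (fun z => F z 0 i)}.
  apply: (@continuous_comp _ _ _ F (fun y : V => y 0 i)); first exact: cF.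
  exact: coord_continuous.
exact: continuousM.
Qed.

Definition penalised_distance (e : R) x y := enorm (y - x) + e * bracket x.

(** The penalty forces the minimum of the distance to be attained. *)
Lemma penalised_distance_min (e : R) (M1 M2 : set V) : 0 < e ->
  closed M1 -> closed M2 -> M1 !=set0 -> M2 !=set0 ->
  exists p q, [/\ M1 p, M2 q & forall x y, M1 x -> M2 y ->
    penalised_distance e p q <= penalised_distance e x y].
Proof.
move=> e0 c1 c2 [x0 M1x0] [y0 M2y0].
pose F (z : V * V) := penalised_distance e z.1 z.2.
pose c := F (x0, y0).
pose ball (r : R) : set V := [set x | `|x| <= r].
have cball r : closed (ball r).
  have -> : ball r = Num.norm @^-1` [set x | x <= r] by [].
  by apply: closed_comp; [move=> x _; exact: norm_continuous|exact: closed_le].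
have compact_ball (M : set V) r : closed M -> compact (M `&` ball r).
  move=> cM; apply: bounded_closed_compact; last exact: closedI.
  exists r; split; first exact: num_real.
  by move=> x rx y [_ /= /le_trans]; apply; exact: ltW.
pose K := (M1 `&` ball (c / e)) `*` (M2 `&` ball (c / e + c)).
have cK : compact K by apply: compact_setX; exact: compact_ball.
have cF : continuous F.
  move=> z; apply: cvgD.
    apply: (@continuous_comp _ _ _
      (fun z : V * V => dot (z.2 - z.1) (z.2 - z.1)) Num.sqrt); last first.
      exact: sqrt_continuous.
    apply: (@continuous_dot _ (fun z : V * V => z.2 - z.1)) => {}z.
    by apply: cvgB; [exact: cvg_snd|exact: cvg_fst].
  apply: cvgMr; apply: (@continuous_comp _ _ _
    (fun z : V * V => 1 + dot z.1 z.1) Num.sqrt); last exact: sqrt_continuous.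
  apply: cvgD; first exact: cvg_cst.
  by apply: (@continuous_dot _ (fun z : V * V => z.1)) => {}z; exact: cvg_fst.
have inK x y : M1 x -> M2 y -> F (x, y) <= c -> K (x, y).
  move=> M1x M2y; rewrite /F/= /penalised_distance => Fc.
  have xc : `|x| <= c / e.
    rewrite ler_pdivlMr// mulrC (le_trans _ Fc)//.
    rewrite (le_trans (_ : _ <= e * bracket x))//; last by rewrite lerDr enorm_ge0.
    by rewrite ler_wpM2l ?(ltW e0)// (le_trans (norm_le_enorm _))// enorm_le_bracket.
  split; split => //=; rewrite /ball/= -(subrK x y) addrC.
  rewrite (le_trans (ler_normD _ _))// lerD//.
  rewrite (le_trans (norm_le_enorm _))// (le_trans _ Fc)// lerDl.
  by rewrite mulr_ge0 ?(ltW e0)// ltW// bracket_gt0.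
have K0 : K (x0, y0) by exact: inK.
have [[p q] pqK min] := compact_EVT_min (ex_intro _ _ K0) cK (continuous_subspaceT cF).
have [[M1p _] [M2q _]] : K (p, q) by move: pqK; rewrite inE.
exists p, q; split => // x y M1x M2y.
have [Fc|/ltW Fc] := leP (F (x, y)) c.
  by apply: (min (x, y)); rewrite inE; exact: inK.
by apply: le_trans Fc; apply: (min (x0, y0)); rewrite inE.
Qed.

End Minimisation.

(** * Second variation of the penalised distance *)

Section SecondVariation.
Context {R : realType} {N : nat}.
Notation V := 'rV[R]_N.
Implicit Types (p q u v w : V).

(** The second variation of the penalised distance between two curves.  The
    square roots are replaced by their tangents, the one of the distance being
    taken at the length [d + t * dot u (w - v)] that is exact when [w - v] is
    parallel to the segment: this is what removes the term of order [1 / d],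
    unless the velocities differ across the segment. *)
Lemma second_variation (e d h1 h2 : R) p q u v w n1 n2 (s1 s2 : R -> R) :
  0 <= e -> 0 < d -> q = p + d *: u -> dot u u = 1 ->
  dot n1 n1 = 1 -> dot n2 n2 = 1 -> dot n1 v = 0 ->
  (forall e' : R, 0 < e' -> \forall t \near (0 : R), `|s1 t - h1 / 2 * t ^+ 2| <= e' * t ^+ 2) ->
  (forall e' : R, 0 < e' -> \forall t \near (0 : R), `|s2 t - h2 / 2 * t ^+ 2| <= e' * t ^+ 2) ->
  (\forall t \near (0 : R), penalised_distance e p q <=
     penalised_distance e (p + t *: v + s1 t *: n1) (q + t *: w + s2 t *: n2)) ->
  let k := e / bracket p in
  let b := dot u (w - v) + k * dot p v in
  0 <= b /\ (b = 0 -> dot u (w - v) ^+ 2 <= dot (w - v) (w - v) +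
    d * (h2 * dot u n2 - h1 * dot u n1 + k * (h1 * dot p n1 + dot v v))).
Proof.
move=> e0 d0 qE uu nn1 nn2 nv S1 S2 Fmin k b.
set dl := w - v in b *; have dlE : dl = w - v by [].
clearbody dl; set mu := dot u dl.
have k0 : 0 <= k by rewrite divr_ge0// ltW// bracket_gt0.
have cvgs (s : R -> R) h :
    (forall e' : R, 0 < e' -> \forall t \near (0 : R),
      `|s t - h / 2 * t ^+ 2| <= e' * t ^+ 2) ->
    (s t / t ^+ 2) @[t --> (0 : R)^'+] --> h / 2.
  move=> S; apply/cvgrPdist_le => eps eps0.
  have S' : \forall t \near (0 : R)^'+, `|s t - h / 2 * t ^+ 2| <= eps * t ^+ 2.
    by apply: cvg_at_right_filter (S eps eps0); exact: cvg_id.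
  near=> t; have t0 : 0 < t by near: t; exact: nbhs_right_gt.
  have t2 : 0 < t ^+ 2 by rewrite exprn_gt0.
  have : `|s t - h / 2 * t ^+ 2| <= eps * t ^+ 2 by near: t.
  rewrite -{1}(ler_pM2r (x := (t ^+ 2)^-1)) ?invr_gt0//.
  rewrite mulfK ?gt_eqF// -{1}(gtr0_norm (x := (t ^+ 2)^-1)) ?invr_gt0// -normrM.
  by rewrite mulrBl mulfK ?gt_eqF// distrC.
have c1 := cvgs _ _ S1; have c2 := cvgs _ _ S2.
pose P (t x y : R) := dot dl dl - mu ^+ 2 + 2 * d * (y * dot u n2 - x * dot u n1)
  + 2 * t * (y * dot dl n2 - x * dot dl n1)
  + t ^+ 2 * (y ^+ 2 + x ^+ 2 - 2 * x * y * dot n1 n2)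
  + (d + t * mu) * k * (2 * x * dot p n1 + dot v v + t ^+ 2 * x ^+ 2).
have key : \forall t \near (0 : R)^'+,
    0 <= 2 * (d + t * mu) * b + t * P t (s1 t / t ^+ 2) (s2 t / t ^+ 2).
  have F' : \forall t \near (0 : R)^'+, penalised_distance e p q <=
     penalised_distance e (p + t *: v + s1 t *: n1) (q + t *: w + s2 t *: n2).
    by apply: cvg_at_right_filter Fmin; exact: cvg_id.
  have mu1 : 0 < `|mu| + 1 by rewrite ltr_wpDl.
  near=> t; have t0 : 0 < t by near: t; exact: nbhs_right_gt.
  have L0 : 0 < d + t * mu.
    have tmu : t * (`|mu| + 1) < d.
      by rewrite -ltr_pdivlMr//; near: t; apply: nbhs_right_lt; rewrite divr_gt0.
    have := ler_norm (- mu); rewrite normrN => nmu.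
    have : t * - mu <= t * `|mu| by rewrite ler_wpM2l// ltW.
    by lra.
  have : penalised_distance e p q <=
     penalised_distance e (p + t *: v + s1 t *: n1) (q + t *: w + s2 t *: n2) by near: t.
  rewrite /penalised_distance.
  have -> : q - p = d *: u by rewrite qE addrC addKr.
  rewrite enormZ gtr0_norm// {1}/enorm uu sqrtr1 mulr1.
  set s := s1 t; set r := s2 t.
  set x := p + _ + _; set y := q + _ + _.
  have A1 := enorm_le_tangent (y - x) L0.
  have A2 := bracket_le_tangent p x.
  set L := d + t * mu in L0 A1 *.
  have bp0 := bracket_gt0 p.
  move=> A3.
  have : d + e * bracket p <= (dot (y - x) (y - x) + L ^+ 2) / (2 * L) +
      e * ((1 + dot x x + bracket p ^+ 2) / (2 * bracket p)).
    by apply: le_trans A3 _; rewrite lerD// ler_wpM2l.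
  have -> : e * bracket p = k * (1 + dot p p).
    by rewrite -(sqr_bracket p) /k; field; rewrite gt_eqF.
  have -> : e * ((1 + dot x x + bracket p ^+ 2) / (2 * bracket p)) =
      k * ((1 + dot x x + (1 + dot p p)) / 2).
    by rewrite -(sqr_bracket p) /k; field; rewrite gt_eqF.
  rewrite -(ler_pM2r (x := 2 * L)) ?mulr_gt0// [leRHS]mulrDl divfK; last first.
    by rewrite gt_eqF// mulr_gt0.
  have yxE : y - x = d *: u + t *: dl + r *: n2 - s *: n1.
    by rewrite /y /x qE dlE; apply/rowP => i; rewrite !mxE; ring.
  have DD : dot (y - x) (y - x) = L ^+ 2 + t ^+ 2 * (dot dl dl - mu ^+ 2) +
      2 * d * (r * dot u n2 - s * dot u n1) + 2 * t * (r * dot dl n2 - s * dot dl n1)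
      + (r ^+ 2 + s ^+ 2 - 2 * s * r * dot n1 n2).
    rewrite yxE !dotE (dotC dl u) (dotC n1 u) (dotC n2 u) (dotC n1 dl) (dotC n2 dl).
    by rewrite (dotC n2 n1) uu nn1 nn2 /L /mu; ring.
  have XX : dot x x = dot p p + 2 * t * dot p v + 2 * s * dot p n1 +
      t ^+ 2 * dot v v + s ^+ 2.
    rewrite /x !dotE (dotC v p) (dotC n1 p) (dotC v n1) nv nn1; ring.
  rewrite DD XX -subr_ge0 => A4.
  rewrite -(pmulr_lge0 _ t0); apply: le_trans A4 _.
  rewrite le_eqVlt; apply/orP; left; apply/eqP.
  by rewrite /P -/s -/r /b -/mu /L; field; rewrite gt_eqF.
have cid0 : t @[t --> (0 : R)^'+] --> (0 : R).
  by apply: cvg_at_right_filter; exact: cvg_id.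
have cvgP : P t (s1 t / t ^+ 2) (s2 t / t ^+ 2) @[t --> (0 : R)^'+] -->
    P 0 (h1 / 2) (h2 / 2).
  have cX (f : R -> R) (a : R) : f t @[t --> (0 : R)^'+] --> a ->
      f t ^+ 2 @[t --> (0 : R)^'+] --> a ^+ 2.
    by move=> cf; rewrite expr2; under eq_fun do rewrite expr2; exact: cvgM.
  have cc (a : R) : a @[t --> (0 : R)^'+] --> a by exact: cvg_cst.
  rewrite /P; apply: cvgD; last first.
    apply: cvgM; first by apply: cvgM => //; apply: cvgD => //; exact: cvgM.
    apply: cvgD; last by apply: cvgM; exact: cX.
    by apply: cvgD => //; apply: cvgM => //; exact: cvgM.
  apply: cvgD; last first.
    apply: cvgM; first exact: cX.
    apply: cvgB; first by apply: cvgD; exact: cX.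
    by apply: cvgM => //; apply: cvgM => //; exact: cvgM.
  apply: cvgD; last first.
    by apply: cvgM; [exact: cvgM|apply: cvgB; exact: cvgM].
  by apply: cvgD => //; apply: cvgM => //; apply: cvgB; exact: cvgM.
split.
  have cb : 2 * (d + t * mu) * b + t * P t (s1 t / t ^+ 2) (s2 t / t ^+ 2)
      @[t --> (0 : R)^'+] --> 2 * (d + 0 * mu) * b + 0 * P 0 (h1 / 2) (h2 / 2).
    apply: cvgD; last exact: cvgM.
    apply: cvgM; last exact: cvg_cst.
    apply: cvgM; first exact: cvg_cst.
    by apply: cvgD; [exact: cvg_cst|apply: cvgM => //; exact: cvg_cst].
  have : 0 <= 2 * (d + 0 * mu) * b + 0 * P 0 (h1 / 2) (h2 / 2).
    exact: cvgr_to_ge cb key.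
  have d2 : 0 < 2 * d by rewrite mulr_gt0.
  by rewrite !mul0r !addr0 (pmulr_rge0 _ d2).
move=> b0; have Pge : \forall t \near (0 : R)^'+,
    0 <= P t (s1 t / t ^+ 2) (s2 t / t ^+ 2).
  near=> t; have t0 : 0 < t by near: t; exact: nbhs_right_gt.
  rewrite -(pmulr_rge0 _ t0).
  have : 0 <= 2 * (d + t * mu) * b + t * P t (s1 t / t ^+ 2) (s2 t / t ^+ 2) by near: t.
  by rewrite b0 mulr0 add0r.
have : 0 <= P 0 (h1 / 2) (h2 / 2) by exact: cvgr_to_ge cvgP Pge.
rewrite /P -subr_ge0 subr0 => H; rewrite -subr_ge0; apply: le_trans H _.
by rewrite le_eqVlt; apply/orP; left; apply/eqP; field.
Unshelve. all: by end_near. Qed.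

End SecondVariation.

(** * Comparison of mean curvatures at a minimum *)

Section ObliqueTrace.
Context {R : realType} {n : nat}.
Notation V := 'rV[R]_n.+1.
Variables (M : set V) (eta : V -> V) (p : V).
Hypotheses (ueta : unit_normal M eta) (Mp : M p).
Implicit Types (u v w : V).

Lemma shape_operatorD v w : shape_operator eta p (v + w) =
  shape_operator eta p v + shape_operator eta p w.
Proof.
rewrite /shape_operator deriveDv ?opprD//.
exact: unit_normal_differentiable ueta Mp.
Qed.

Lemma shape_operatorZ k v :
  shape_operator eta p (k *: v) = k *: shape_operator eta p v.
Proof.
rewrite /shape_operator deriveZv ?scalerN//.
exact: unit_normal_differentiable ueta Mp.
Qed.

Lemma shape_operator_sum I (r : seq I) (F : I -> V) :
  shape_operator eta p (\sum_(i <- r) F i) = \sum_(i <- r) shape_operator eta p (F i).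
Proof.
rewrite /shape_operator derive_sumv ?sumrN//.
exact: unit_normal_differentiable ueta Mp.
Qed.

(** Tracing over the projections of the basis along [u] rather than along the
    normal adds the value of the form at the difference of the directions. *)
Lemma oblique_trace u : n != 0%N -> dot (eta p) u != 0 ->
  let z := eta p - (dot (eta p) u)^-1 *: u in
  let v i := delta_mx 0 i - (dot (eta p) (delta_mx 0 i) / dot (eta p) u) *: u in
  \sum_i dot (shape_operator eta p (v i)) (v i) =
    n%:R * mean_curvature eta p + dot (shape_operator eta p z) z.
Proof.
move=> n0 u0 z v.
pose E i := tproj eta p (delta_mx 0 i).
pose c i := dot (eta p) (delta_mx 0 i).
have vE i : v i = E i + c i *: z.
  rewrite /v /E /tproj /z -/(c i) [dot (delta_mx 0 i) _]dotC -/(c i).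
  by rewrite scalerBr scalerA addrA subrK.
have cE : \sum_i c i *: E i = 0.
  transitivity (tproj eta p (eta p)); last exact: tproj_normal ueta Mp.
  rewrite [X in _ = tproj _ _ X](row_sum_dot (eta p)).
  rewrite /tproj dot_suml scaler_suml -sumrB; apply: eq_bigr => i _.
  by rewrite dotZl scalerBr scalerA.
have c2 : \sum_i c i * c i = 1.
  by rewrite sum_dot_delta (unit_normal_dot ueta Mp).
rewrite -(trace_shape_operator eta p n0) -/E.
set A := shape_operator eta p.
have AE i : dot (A (v i)) (v i) = dot (A (E i)) (E i) +
    (dot (A (c i *: E i)) z + dot (A z) (c i *: E i)) + c i * c i * dot (A z) z.
  rewrite vE /A shape_operatorD (shape_operatorZ _ z) (shape_operatorZ _ (E i)) -/A.
  have alg k (a1 a2 e1 e2 : V) : dot (a1 + k *: a2) (e1 + k *: e2) =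
      dot a1 e1 + (dot (k *: a1) e2 + dot a2 (k *: e1)) + k * k * dot a2 e2.
    by rewrite !dotE; ring.
  exact: alg.
rewrite (eq_bigr _ (fun i _ => AE i)) !big_split/= -mulr_suml c2 mul1r.
congr (_ + _); rewrite -dot_suml -shape_operator_sum cE.
have -> : \sum_i dot (A z) (c i *: E i) = dot (\sum_i c i *: E i) (A z).
  by rewrite dot_suml; apply: eq_bigr => i _; rewrite dotC.
have A0 : A 0 = 0 by rewrite /A /shape_operator derive0 oppr0.
by rewrite cE /= -/A A0 !dot0l !addr0.
Qed.

End ObliqueTrace.

Section Comparison.
Context {R : realType} {n : nat}.
Notation V := 'rV[R]_n.+1.
Variables (M1 M2 : set V) (eta1 eta2 : V -> V).
Hypotheses (hM1 : embedded_hypersurface M1) (ueta1 : unit_normal M1 eta1).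
Hypotheses (hM2 : embedded_hypersurface M2) (ueta2 : unit_normal M2 eta2).
Variables (e d : R) (p q u : V).
Hypotheses (M1p : M1 p) (M2q : M2 q).
Hypotheses (e0 : 0 < e) (e4 : e <= 1 / 4) (d0 : 0 < d).
Hypotheses (qE : q = p + d *: u) (uu : dot u u = 1).
Hypothesis Fmin : forall x y, M1 x -> M2 y ->
  penalised_distance e p q <= penalised_distance e x y.
Implicit Types (v w : V).

Let A1 := shape_operator eta1 p.
Let A2 := shape_operator eta2 q.
Let k := e / bracket p.

Lemma minimum_variation v w : dot (eta1 p) v = 0 -> dot (eta2 q) w = 0 ->
  let b := dot u (w - v) + k * dot p v in
  0 <= b /\ (b = 0 -> dot u (w - v) ^+ 2 <= dot (w - v) (w - v) +
    d * (dot (A2 w) w * dot u (eta2 q) - dot (A1 v) v * dot u (eta1 p)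
      + k * (dot (A1 v) v * dot p (eta1 p) + dot v v))).
Proof.
move=> ev ew.
have [s1 S1] := tangent_curve hM1 ueta1 M1p ev.
have [s2 S2] := tangent_curve hM2 ueta2 M2q ew.
apply: (@second_variation _ _ e d _ _ p q u v w (eta1 p) (eta2 q) s1 s2
  (ltW e0) d0 qE uu (unit_normal_dot ueta1 M1p) (unit_normal_dot ueta2 M2q) ev).
- by move=> e' /S1; apply: filterS => t [].
- by move=> e' /S2; apply: filterS => t [].
- near=> t; apply: Fmin.
    by have [//|] := near (S1 1 ltr01) t.
  by have [//|] := near (S2 1 ltr01) t.
Unshelve. all: by end_near. Qed.

Lemma minimum_first_order v w : dot (eta1 p) v = 0 -> dot (eta2 q) w = 0 ->
  dot u (w - v) + k * dot p v = 0.
Proof.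
move=> ev ew; have [b0 _] := minimum_variation ev ew.
have ev' : dot (eta1 p) (- v) = 0 by rewrite dotNr ev oppr0.
have ew' : dot (eta2 q) (- w) = 0 by rewrite dotNr ew oppr0.
have [b1 _] := minimum_variation ev' ew'.
move: b0 b1; rewrite !dotE => b0 b1; apply/eqP; rewrite eq_le b0 andbT.
by move: b1; lra.
Qed.

(* [c] is the length, up to sign, of the normal vector [u - k *: p] of [M1]. *)
Let b1 := dot (eta1 p) u.
Let b2 := dot (eta2 q) u.
Let c := b1 - k * dot p (eta1 p).

(** Otherwise moving [q] alone, against the tangential part of [u], would
    shorten the segment. *)
Lemma minimum_normal2 : u = b2 *: eta2 q.
Proof.
have e22 := unit_normal_dot ueta2 M2q.
have ew : dot (eta2 q) (u - b2 *: eta2 q) = 0.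
  by rewrite !dotE e22 mulr1 subrr.
have := minimum_first_order (dot0r (eta1 p)) ew.
rewrite subr0 dot0r mulr0 addr0 => uw.
apply/eqP; rewrite -subr_eq0 -dot_eq0 [X in X == _]dotDl uw.
by rewrite dotNl dotZl ew mulr0 oppr0 addr0.
Qed.

(** The point [p] feels the gradient [k *: p] of the penalty in addition to
    that of the distance. *)
Lemma minimum_normal1 : u - k *: p = c *: eta1 p.
Proof.
have e11 := unit_normal_dot ueta1 M1p.
set x := u - k *: p.
have ev : dot (eta1 p) (x - c *: eta1 p) = 0.
  rewrite /x /c !dotE e11 -/b1 (dotC (eta1 p) p); ring.
have := minimum_first_order ev (dot0r (eta2 q)).
rewrite sub0r dotNr -dotZl => ux.
have {}ux : dot x (x - c *: eta1 p) = 0.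
  by move: ux; rewrite {2}/x dotDl dotNl; lra.
apply/eqP; rewrite -subr_eq0 -dot_eq0 [X in X == _]dotDl ux.
by rewrite dotNl dotZl ev mulr0 oppr0 addr0.
Qed.

Lemma penalty_slope : 0 <= k <= e.
Proof.
rewrite divr_ge0 ?(ltW e0) ?(ltW (bracket_gt0 p))//=.
by rewrite ler_pdivrMr ?bracket_gt0// ler_peMr ?bracket_ge1// ltW.
Qed.

Lemma penalty_gradient w : dot w w = 1 -> `|k * dot p w| <= e.
Proof.
move=> w1; rewrite normrM ger0_norm; last by case/andP: penalty_slope.
rewrite /k mulrAC ler_pdivrMr ?bracket_gt0// ler_wpM2l ?(ltW e0)//.
rewrite (le_trans (ler_dot_enorm _ _))// {2}/enorm w1 sqrtr1 mulr1.
exact: enorm_le_bracket.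
Qed.

Hypothesis side : 0 <= b1.

(** The length of [u - k *: p] is within [e] of one, which determines [c] up
    to sign; the sign comes from [side]. *)
Lemma minimum_angle : [/\ 1 - e <= c, c <= 1 + e, 1 - 2 * e <= b1 & b1 <= 1].
Proof.
have e11 := unit_normal_dot ueta1 M1p.
have := penalty_gradient e11; rewrite ler_norml => /andP[g1 g2].
have := penalty_gradient uu; rewrite ler_norml => /andP[g3 g4].
have b11 : b1 <= 1.
  rewrite (le_trans (ler_norm _))// (le_trans (ler_dot_enorm _ _))//.
  by rewrite /enorm uu e11 sqrtr1 mulr1.
have cc : c = c * dot (eta1 p) (eta1 p) by rewrite e11 mulr1.
have c2 : c ^+ 2 = 1 - 2 * (k * dot p u) + k ^+ 2 * dot p p.
  have : dot (u - k *: p) (u - k *: p) = c ^+ 2.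
    by rewrite minimum_normal1 dotZl dotZr e11 mulr1 expr2.
  by move=> <-; rewrite !dotE uu (dotC u p); ring.
have [k0 ke] := andP penalty_slope.
have kp : 0 <= k * enorm p <= e.
  rewrite mulr_ge0 ?enorm_ge0//= /k mulrAC ler_pdivrMr ?bracket_gt0//.
  by rewrite ler_wpM2l ?(ltW e0)// enorm_le_bracket.
have kpu : `|k * dot p u| <= k * enorm p.
  rewrite normrM ger0_norm// ler_wpM2l// (le_trans (ler_dot_enorm _ _))//.
  by rewrite {2}/enorm uu sqrtr1 mulr1.
move: kpu kp c2; rewrite -sqr_enorm -exprMn; move: (k * enorm p) => m.
rewrite ler_norml => /andP[m1 m2] /andP[m0 me] c2.
have cl : (1 - m) ^+ 2 <= c ^+ 2 by rewrite c2 sqrrB expr1n; lra.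
have cr : c ^+ 2 <= (1 + m) ^+ 2 by rewrite c2 sqrrD expr1n; lra.
have ce : - e <= c by rewrite /c; move: side; lra.
have sq (x y : R) : 0 <= x -> 0 <= y -> x ^+ 2 <= y ^+ 2 -> x <= y.
  by move=> x0 y0; rewrite ler_pXn2r// nnegrE.
have cge0 : 0 <= c.
  rewrite leNgt; apply/negP => cneg.
  have K : 1 - m <= - c by apply: sq; rewrite ?sqrrN//; move: me e4 cneg; lra.
  by move: K ce me e4; lra.
have c1 : 1 - e <= c.
  have K : 1 - m <= c by apply: sq => //; move: me e4; lra.
  by move: K me; lra.
have c3 : c <= 1 + e.
  have K : c <= 1 + m by apply: sq => //; move: m0; lra.
  by move: K me; lra.
split => //; have : b1 = c + k * dot p (eta1 p) by rewrite /c subrK.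
lra.
Qed.

(** The sum of the second variations over velocities [v i], [w i] that are the
    projections along [u] of the standard basis onto the two tangent spaces,
    so that every [w i - v i] is a multiple of [u]. *)
Lemma minimum_trace z : n != 0%N -> z = eta1 p - b1^-1 *: u ->
  0 <= n%:R * (b2 * mean_curvature eta2 q) -
    c * (n%:R * mean_curvature eta1 p + dot (A1 z) z)
    + k * (n%:R - 1 + b1 ^- 2).
Proof.
move=> n0 zE; have [c1 c3 b1l b1r] := minimum_angle.
have b10 : b1 != 0 by rewrite gt_eqF//; move: b1l e4; lra.
have e11 := unit_normal_dot ueta1 M1p.
have e22 := unit_normal_dot ueta2 M2q.
have b22 : b2 * b2 = 1.
  by move: uu; rewrite {1 2}minimum_normal2 dotZl dotZr e22 mulr1.
pose v i : V := delta_mx 0 i - (dot (eta1 p) (delta_mx 0 i) / b1) *: u.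
pose w i : V := tproj eta2 q (delta_mx 0 i).
have wE i : w i = delta_mx 0 i - dot u (delta_mx 0 i) *: u.
  rewrite /w /tproj {1 2}minimum_normal2 dotZl scalerA mulrAC b22 mul1r.
  by rewrite [dot (delta_mx _ _) _]dotC.
have ev i : dot (eta1 p) (v i) = 0.
  by rewrite /v !dotE -/b1 divfK// subrr.
have ew i : dot (eta2 q) (w i) = 0 by exact: (dot_normal_tproj ueta2 M2q).
have main i : 0 <= b2 * dot (A2 (w i)) (w i) - c * dot (A1 (v i)) (v i)
    + k * dot (v i) (v i).
  have [_] := minimum_variation (ev i) (ew i).
  move=> /(_ (minimum_first_order (ev i) (ew i))).
  have -> : w i - v i = (dot (eta1 p) (delta_mx 0 i) / b1 - dot u (delta_mx 0 i)) *: u.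
    by rewrite wE /v [RHS]scalerBl opprB [LHS]addrC addrA subrK.
  rewrite dotZr uu mulr1 dotZl dotZr uu mulr1 -expr2 -lerBlDl subrr.
  rewrite pmulr_rge0// (dotC u (eta2 q)) (dotC u (eta1 p)) -/b1 -/b2.
  rewrite /c; move: (dot (A2 _) _) (dot (A1 _) _) (dot (v i) _) => x y t H.
  by apply: le_trans H _; rewrite le_eqVlt; apply/orP; left; apply/eqP; ring.
have : 0 <= \sum_i (b2 * dot (A2 (w i)) (w i) - c * dot (A1 (v i)) (v i)
    + k * dot (v i) (v i)) by apply: sumr_ge0 => i _.
rewrite big_split sumrB -!mulr_sumr /=.
have -> : \sum_i dot (A2 (w i)) (w i) = n%:R * mean_curvature eta2 q.
  exact: trace_shape_operator.
have -> : \sum_i dot (A1 (v i)) (v i) =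
    n%:R * mean_curvature eta1 p + dot (A1 z) z.
  by rewrite zE; exact: (oblique_trace ueta1 M1p n0 b10).
have -> : \sum_i dot (v i) (v i) = n%:R - 1 + b1 ^- 2.
  have vv i : dot (v i) (v i) = dot (delta_mx 0 i : V) (delta_mx 0 i) -
      2 / b1 * (dot (eta1 p) (delta_mx 0 i) * dot u (delta_mx 0 i)) +
      b1 ^- 2 * (dot (eta1 p) (delta_mx 0 i) * dot (eta1 p) (delta_mx 0 i)).
    rewrite /v !dotE uu (dotC (delta_mx 0 i) u).
    move: (dot (delta_mx _ _) _) (dot (eta1 p) _) (dot u _) => x y t.
    by field.
  rewrite (eq_bigr _ (fun i _ => vv i)) big_split sumrB -!mulr_sumr /=.
  rewrite sum_dot_delta2 !sum_dot_delta e11 -/b1 mulr1 divfK//.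
  by rewrite -natr1; ring.
by rewrite mulrCA.
Qed.

(** Letting [e] tend to [0] in the conclusion gives [a <= h]. *)
Lemma mean_curvature_comparison (S h a : R) : n != 0%N -> 0 <= S -> 0 <= a ->
  (forall v, dot (eta1 p) v = 0 -> `|dot (A1 v) v| <= S * dot v v) ->
  `|mean_curvature eta2 q| <= h -> a <= mean_curvature eta1 p ->
  n%:R * (a - h) <= e * (n%:R * a + 32 * S + n%:R + 3).
Proof.
move=> n0 S0 a0 Sb H2 H1.
have [c1 c3 b1l b1r] := minimum_angle.
(* The numerical constants below come from [1 / 2 <= b1] and [c <= 2]. *)
have b1p : 1 / 2 <= b1 by move: b1l e4; lra.
have b10 : 0 < b1 by move: b1p; lra.
set z := eta1 p - b1^-1 *: u.
have := minimum_trace n0 (erefl z).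
have e11 := unit_normal_dot ueta1 M1p.
have e22 := unit_normal_dot ueta2 M2q.
have n1 : (0 : R) <= n%:R by [].
have ib : b1^-1 <= 2.
  by rewrite -[2]invrK lef_pV2 ?posrE ?invr_gt0//; move: b1p; lra.
have ib0 : 0 < b1^-1 by rewrite invr_gt0.
have ib2 : b1 ^- 2 <= 4.
  have -> : b1 ^- 2 = b1^-1 ^+ 2 by rewrite exprVn.
  have -> : (4 : R) = 2 ^+ 2 by ring.
  by rewrite ler_pXn2r// nnegrE ltW.
have zz : dot z z = b1 ^- 2 - 1.
  rewrite /z !dotE uu e11 (dotC u) -/b1.
  by field; rewrite gt_eqF.
have zz16 : dot z z <= 16 * e.
  rewrite zz (_ : b1 ^- 2 - 1 = (1 - b1 ^+ 2) * b1 ^- 2); last first.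
    by field; rewrite gt_eqF.
  have -> : 16 * e = 4 * e * 4 by ring.
  apply: ler_pM => //.
  - by rewrite subr_ge0 expr_le1// ltW.
  - by rewrite invr_ge0 exprn_ge0// ltW.
  - have : (1 - 2 * e) ^+ 2 <= b1 ^+ 2.
      by rewrite ler_pXn2r// ?nnegrE ?(ltW b10)//; move: e4; lra.
    by have := sqr_ge0 e; rewrite sqrrB expr1n exprMn; lra.
have ez : dot (eta1 p) z = 0.
  by rewrite /z !dotE e11 -/b1 mulVf ?subrr// gt_eqF.
have := Sb z ez; rewrite ler_norml => /andP[Az _].
have {}Az : - (16 * S * e) <= dot (A1 z) z.
  apply: le_trans Az; rewrite lerN2 (_ : 16 * S * e = S * (16 * e)); last by ring.
  by rewrite ler_wpM2l.
have b2H : n%:R * (b2 * mean_curvature eta2 q) <= n%:R * h.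
  rewrite ler_wpM2l// (le_trans (ler_norm _))// normrM.
  have -> : `|b2| = 1.
    have b22 : b2 ^+ 2 = 1.
      by move: uu; rewrite {1 2}minimum_normal2 dotZl dotZr e22 mulr1 expr2.
    by apply/eqP; rewrite -(@eqrXn2 _ 2)// real_normK ?num_real// b22 expr1n.
  by rewrite mul1r.
have cH : (1 - e) * (n%:R * a) <= c * (n%:R * mean_curvature eta1 p).
  apply: ler_pM => //; [by move: e4; lra|exact: mulr_ge0|].
  by rewrite ler_wpM2l.
have cA : - (32 * S * e) <= c * dot (A1 z) z.
  have c0 : 0 <= c by move: c1 e4; lra.
  have : c * - (16 * S * e) <= c * dot (A1 z) z by rewrite ler_wpM2l.
  apply: le_trans; rewrite mulrN lerN2.
  rewrite (_ : 32 * S * e = 2 * (16 * S * e)); last by ring.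
  rewrite ler_wpM2r ?mulr_ge0 ?(ltW e0)//; move: c3 e4; lra.
have kb : k * (n%:R - 1 + b1 ^- 2) <= e * (n%:R + 3).
  have [k0 ke] := andP penalty_slope.
  apply: ler_pM => //; last by move: ib2; lra.
  have n11 : (1 : R) <= n%:R by rewrite ler1n lt0n.
  have : 0 <= b1 ^- 2 by rewrite invr_ge0 exprn_ge0// ltW.
  lra.
move: b2H cH cA kb; rewrite [c * (_ + _)]mulrDr.
move: (n%:R * (b2 * _)) (c * (n%:R * _)) (c * dot _ _) (k * _) => x1 x2 x3 x4.
lra.
Qed.

End Comparison.

(** * Separation from the convex side *)

Section Separation.
Context {R : realType} {n : nat}.
Notation V := 'rV[R]_n.+1.
Implicit Types (M C : set V) (eta : V -> V) (p q : V).

Lemma convex_side_neq0 M eta C : is_convex_side M eta C -> M !=set0.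
Proof.
move=> [[a [b [_ Mb CE Cb _]]] _]; apply/set0P/eqP => M0.
have ab : connected_component (~` M) a b.
  by apply: component_segment => t _; rewrite M0.
have : (C `&` connected_component (~` M) b) b.
  by rewrite CE; split => //; exact: connected_component_refl.
by rewrite Cb.
Qed.

Lemma enorm_mean_curvature_vector M eta p : unit_normal M eta -> M p ->
  enorm (mean_curvature_vector eta p) = `|mean_curvature eta p|.
Proof.
by move=> h Mp; rewrite enormZ /enorm (unit_normal_dot h Mp) sqrtr1 mulr1.
Qed.

(** The minimality of the penalised distance keeps the segment off [M1],
    because the penalty has slope less than one. *)
Lemma minimum_segment M1 M2 C eta (e : R) p q : 0 < e -> e < 1 ->
  is_convex_side M1 eta C -> M1 `&` M2 = set0 -> M2 `<=` C ->
  M1 p -> M2 q ->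
  (forall x y, M1 x -> M2 y ->
    penalised_distance e p q <= penalised_distance e x y) ->
  forall t : R, 0 < t -> t <= 1 -> C (p + t *: (q - p)).
Proof.
move=> e0 e1 hC dM MC M1p M2q Fmin t t0 t1.
have pq : q - p != 0.
  apply/eqP => /subr0_eq qp; have : (M1 `&` M2) p by split => //; rewrite -qp.
  by rewrite dM.
have off (s : R) : 0 < s -> s <= 1 -> ~ M1 (p + s *: (q - p)).
  move=> s0 s1 /Fmin /(_ M2q); apply/negP; rewrite -ltNge /penalised_distance.
  have -> : q - (p + s *: (q - p)) = (1 - s) *: (q - p).
    by rewrite scalerBl scale1r opprD addrA.
  have := bracket_lipschitz p (s *: (q - p)).
  rewrite !enormZ gtr0_norm// ger0_norm ?subr_ge0//.
  have d0 := enorm_gt0 pq; set d := enorm _ in d0 *.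
  set x := bracket (p + _); set y := bracket p => xy.
  have : e * x <= e * y + e * (s * d) by rewrite -mulrDr ler_wpM2l// ltW.
  have : e * (s * d) < 1 * (s * d) by rewrite ltr_pM2r// mulr_gt0.
  by lra.
have [[a [b [_ _ CE _ _]]] _] := hC.
have Cq := MC q M2q.
move: Cq; rewrite CE => aq; apply: connected_component_trans aq _.
apply: component_segment => s /andP[s0 s1].
have -> : q + s *: (p + t *: (q - p) - q) = p + (1 - s + s * t) *: (q - p).
  by apply/rowP => i; rewrite !mxE; ring.
apply: off.
  have [->|s1'] := eqVneq s 1; first by rewrite subrr add0r mul1r.
  by rewrite ltr_wpDr ?mulr_ge0 ?(ltW t0)// subr_gt0 lt_def eq_sym s1'.
have : s * t <= s * 1 by rewrite ler_wpM2l.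
by lra.
Qed.

Lemma mean_curvature_bounds M1 M2 eta1 eta2 : unit_normal M2 eta2 ->
  M1 !=set0 -> M2 !=set0 ->
  (ereal_sup [set (enorm (mean_curvature_vector eta2 p))%:E | p in M2]
         < ereal_inf [set (mean_curvature eta1 p)%:E | p in M1])%E ->
  exists h a : R, [/\ 0 <= h, h < a,
    forall q, M2 q -> `|mean_curvature eta2 q| <= h
  & forall p, M1 p -> a <= mean_curvature eta1 p].
Proof.
move=> ueta2 [p0 M1p0] [q0 M2q0].
have ub q : M2 q -> ((`|mean_curvature eta2 q|)%:E <=
    ereal_sup [set (enorm (mean_curvature_vector eta2 p))%:E | p in M2])%E.
  move=> M2q; apply: ereal_sup_ubound; exists q => //.
  by rewrite (enorm_mean_curvature_vector ueta2 M2q).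
have lb p : M1 p -> (ereal_inf [set (mean_curvature eta1 p)%:E | p in M1] <=
    (mean_curvature eta1 p)%:E)%E.
  by move=> M1p; apply: ereal_inf_lbound; exists p.
move: ub lb; case: (ereal_sup _) => [h| |]; case: (ereal_inf _) => [a| |] ub lb //.
- rewrite lte_fin => ha; exists h, a; split => //.
  + by rewrite (le_trans (normr_ge0 _) (ub q0 M2q0)).
- by have := lb p0 M1p0.
- by have := ub q0 M2q0.
- by have := ub q0 M2q0.
Qed.

End Separation.

Theorem mainTheorem5 (R : realType) (n : nat) (hn : (2 <= n)%N)
  (M1 M2 : set 'rV[R]_n.+1) (eta1 eta2 : 'rV[R]_n.+1 -> 'rV[R]_n.+1)
  (hM1 : properly_embedded_hypersurface M1) (heta1 : unit_normal M1 eta1)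
  (connM1 : connected M1)
  (hM2 : properly_embedded_hypersurface M2) (heta2 : unit_normal M2 eta2)
  (M2_neq0 : M2 !=set0)
  (disjM : M1 `&` M2 = set0)
  (complM2 : complete_hypersurface M2)
  (ricM2 : ricci_bounded_below M2 eta2)
  (scalM1 : forall p, M1 p -> 0 <= normalized_scalar_curvature eta1 p)
  (bndM1 : exists K : R, forall p, M1 p -> `|mean_curvature eta1 p| <= K)
  (hH : (ereal_sup [set (enorm (mean_curvature_vector eta2 p))%:E | p in M2]
         < ereal_inf [set (mean_curvature eta1 p)%:E | p in M1])%E)
  (C : set 'rV[R]_n.+1) (hC : is_convex_side M1 eta1 C) :
  ~ (M2 `<=` C).
Proof.
move=> MC; have M1_neq0 := convex_side_neq0 hC.
have [embM1 clM1] := hM1; have [embM2 clM2] := hM2.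
have [h [a [h0 ha H2 H1]]] := mean_curvature_bounds heta2 M1_neq0 M2_neq0 hH.
have [K HK] := bndM1.
have n0 : n != 0%N by move: hn; case: (n).
have npos : (0 : R) < n%:R by rewrite ltr0n lt0n.
have K0 : 0 <= K by have [p0 Mp0] := M1_neq0; exact: le_trans (normr_ge0 _) (HK p0 Mp0).
have a0 : 0 <= a by exact: le_trans (ltW ha).
set S := n%:R * K.
have S0 : 0 <= S by rewrite mulr_ge0.
have A1_bound p v : M1 p -> dot (eta1 p) v = 0 ->
    `|dot (shape_operator eta1 p v) v| <= S * dot v v.
  move=> Mp; apply: (shape_operator_bound embM1 heta1 Mp n0) => //.
  have scal : 0 <= scalar_curvature eta1 p.
    have := scalM1 p Mp; rewrite /normalized_scalar_curvature pmulr_lge0//.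
    by rewrite invr_gt0 mulr_gt0// subr_gt0 ltr1n.
  rewrite lerBlDr (@le_trans _ _ (S ^+ 2))// ?lerDl// /S.
  rewrite (exprMn 2 _ (mean_curvature eta1 p)) (exprMn 2 _ K) ler_wpM2l ?sqr_ge0//.
  rewrite -(real_normK (num_real (mean_curvature eta1 p))).
  by rewrite ler_pXn2r// ?nnegrE ?normr_ge0// HK.
pose B := n%:R * a + 32 * S + n%:R + 3.
have B0 : 0 < B.
  have : 0 <= n%:R * a by rewrite mulr_ge0.
  by rewrite /B; move: npos S0; lra.
have nah : 0 < n%:R * (a - h) by rewrite mulr_gt0// subr_gt0.
(* The factor [2] makes the inequality [eB] strict. *)
pose e := Num.min (1 / 4) (n%:R * (a - h) / (2 * B)).
have e0 : 0 < e by rewrite lt_min !divr_gt0// mulr_gt0.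
have e4 : e <= 1 / 4 by rewrite ge_min lexx.
have eB : e * B < n%:R * (a - h).
  apply: (@le_lt_trans _ _ (n%:R * (a - h) / (2 * B) * B)).
    by rewrite ler_wpM2r ?(ltW B0)// ge_min lexx orbT.
  rewrite (_ : _ * B = n%:R * (a - h) / 2); last by field; rewrite gt_eqF.
  by rewrite ltr_pdivrMr// ltr_pMr// ltr1n.
have e1 : e < 1 by move: e4; lra.
have [p [q [M1p M2q Fmin]]] := penalised_distance_min e0 clM1 clM2 M1_neq0 M2_neq0.
have seg := minimum_segment e0 e1 hC disjM MC M1p M2q Fmin.
have pq : q - p != 0.
  apply/eqP => /subr0_eq qp; have : (M1 `&` M2) p by split => //; rewrite -qp.
  by rewrite disjM.
pose d := enorm (q - p); have d0 : 0 < d by exact: enorm_gt0.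
pose u := d^-1 *: (q - p).
have qE : q = p + d *: u by rewrite /u scalerA divff ?gt_eqF// scale1r addrC subrK.
have uu : dot u u = 1.
  by rewrite /u dotZl dotZr -sqr_enorm -/d; field; rewrite gt_eqF.
have side : 0 <= dot (eta1 p) u.
  apply: (convex_side_direction embM1 heta1 connM1 clM1 _ hC M1p).
    by move=> x Mx; apply: lt_le_trans (H1 x Mx); exact: le_lt_trans ha.
  near=> t; have t0 : 0 < t by near: t; exact: nbhs_right_gt.
  rewrite /u scalerA; apply: seg; first by rewrite divr_gt0.
  by rewrite ler_pdivrMr// mul1r; near: t; exact: nbhs_right_le.
have := mean_curvature_comparison embM1 heta1 embM2 heta2 M1p M2q e0 e4 d0 qE uu
  Fmin side n0 S0 a0 (fun v => A1_bound p v M1p) (H2 q M2q) (H1 p M1p).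
by rewrite leNgt eB.
Unshelve. all: by end_near. Qed.
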